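(* Let $G(\mathcal V,\mathcal E)$ be a directed graph satisfying Assumption 1 (see context), let $\mathcal F\subseteq\mathcal V$ with $|\mathcal F|=\phi\le f$ be the set of Byzantine agents of an execution, $\mathcal N=\mathcal V-\mathcal F$, let $\tau_b$ be the number of reduced graphs of $G$ (under Byzantine faults, for this $\mathcal F$), and let $d_{\max}=\max_{j\in\mathcal V}d_j^-$. Let $\gamma\ge f+1$ and suppose each reduced graph (for this $\mathcal F$) contains a source component of size at least $\gamma$. Let $$\beta\le\frac{1}{\big(2(d_{\max}+1-2f)\big)^{\tau_b(n-\phi)}}.$$ Then Algorithm 1 optimizes a function in $\mathcal A(\beta,\gamma)$; that is, in every execution of Algorithm 1 with faulty set $\mathcal F$, the states of the non-faulty agents satisfy $$\lim_{t\to\infty}|x_i[t]-x_j[t]|=0\quad\text{for all } i,j\in\mathcal N,\qquad \lim_{t\to\infty}\mathrm{Dist}\big(x_i[t],Y(\beta,\gamma)\big)=0\quad\text{for all } i\in\mathcal N.$$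
   Context: **System.** A synchronous system of $n$ agents $\mathcal V=\{1,\dots,n\}$ communicates over a directed graph $G(\mathcal V,\mathcal E)$ without self-loops. $N_i^-=\{j:(j,i)\in\mathcal E\}$ and $d_i^-=|N_i^-|$. Up to $f$ agents are Byzantine: they may behave arbitrarily, in particular send different arbitrary real values to different out-neighbours. $\mathcal F$ is the set of faulty agents. **Local functions.** $\mathcal X\subseteq\mathbb R$ is a nonempty closed convex set and $L$ is a fixed constant. Each agent $i$ has an admissible function $h_i:\mathcal X\to\mathbb R$: convex, continuously differentiable, $h_i'$ is $L$-Lipschitz, $|h_i'(x)|\le L$ on $\mathcal X$, and $\arg\min_{x\in\mathcal X}h_i(x)$ is nonempty and compact. $P_{\mathcal X}$ is the projection onto $\mathcal X$; $\mathrm{Dist}(x,S)=\inf_{y\in S}|x-y|$. **Reduced graphs.** For a faulty set $\mathcal F$, a reduced graph under Byzantine faults is any subgraph of $G$ obtained by removing all agents of $\mathcal F$ with their edges and then removing up to $f$ additional incoming edges at each agent of $\mathcal N$ (so its vertex set is $\mathcal N$). A source component of a graph is the (nonempty) collection of all agents each of which has a directed path to every other agent of the graph. Assumption 1: for every possible faulty set of size at most $f$, every reduced graph contains a source component (this implies that the in-degrees are large enough for the trimming below to make sense). **Valid functions.** $\mathcal A(\beta,\gamma)$ is the set of functions $p=\sum_{i\in\mathcal N}\alpha_ih_i$ with $\alpha_i\ge0$, $\sum_{i\in\mathcal N}\alpha_i=1$ and $|\{i\in\mathcal N:\alpha_i\ge\beta\}|\ge\gamma$; $Y(\beta,\gamma)=\bigcup_{p\in\mathcal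 A(\beta,\gamma)}\arg\min_{x\in\mathcal X}p(x)$. **Stepsizes.** $\lambda[t]>0$, $\lambda[t+1]\le\lambda[t]$ for $t\ge 0$, $\sum_t\lambda[t]=\infty$, $\sum_t\lambda^2[t]<\infty$. **Algorithm 1.** Each agent $i$ has an initial state $x_i[0]\in\mathcal X$. In iteration $t\ge1$ each non-faulty agent $i$: (1) sends $x_i[t-1]$ on all outgoing edges; (2) receives one value $w_j[t-1]$ from each $j\in N_i^-$ (a missing value is replaced by a default value; $w_j[t-1]=x_j[t-1]$ if $j$ is non-faulty); (3) sorts the $d_i^-$ received values, discards the $f$ smallest and the $f$ largest (ties broken arbitrarily), lets $N_i^*[t]$ be the senders of the remaining $d_i^--2f$ values, puts $w_i[t-1]=x_i[t-1]$, and sets $$x_i[t]=P_{\mathcal X}\Big[\tfrac{1}{d_i^-+1-2f}\sum_{j\in\{i\}\cup N_i^*[t]}w_j[t-1]-\lambda[t-1]\,h_i'(x_i[t-1])\Big].$$ *)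

(* Defs.v *)
From HB Require Import structures.
From mathcomp Require Export all_boot all_order all_algebra.
From mathcomp Require Export all_classical all_reals all_analysis.

Set Implicit Arguments.
Unset Strict Implicit.
Unset Printing Implicit Defensive.

Export Order.TTheory GRing.Theory Num.Theory.
Export numFieldNormedType.Exports.

#[export] Set Implicit Arguments.
#[export] Unset Strict Implicit.
#[export] Unset Printing Implicit Defensive.

Local Open Scope classical_set_scope.
Local Open Scope ring_scope.

(** The agents are the elements of ['I_n]; [e j i] says that (j, i) is
    an edge, i.e. that j sends to i. *)

Definition in_nbrs (n : nat) (e : rel 'I_n) (i : 'I_n) : {set 'I_n} :=
  [set j | e j i]%SET.

Definition in_degree (n : nat) (e : rel 'I_n) (i : 'I_n) : nat :=
  #|in_nbrs e i|.

Definition max_in_degree (n : nat) (e : rel 'I_n) : nat :=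
  (\max_(j < n) in_degree e j)%N.

Definition fault_free_edges (n : nat) (e : rel 'I_n) (F : {set 'I_n}) :
    {set 'I_n * 'I_n} :=
  [set p | [&& p.1 \notin F, p.2 \notin F & e p.1 p.2]]%SET.

(** All reduced graphs for the faulty set F have vertex set ~: F, so a reduced
    graph is given by its set H of edges. *)
Definition reduced_graph (n : nat) (e : rel 'I_n) (f : nat) (F : {set 'I_n})
    (H : {set 'I_n * 'I_n}) : bool :=
  (H \subset fault_free_edges e F) &&
  [forall (i | i \notin F),
     #|[set j | (j, i) \in fault_free_edges e F :\: H]%SET| <= f]%N.

Definition num_reduced_graphs (n : nat) (e : rel 'I_n) (f : nat)
    (F : {set 'I_n}) : nat :=
  #|[set H | reduced_graph e f F H]%SET|.

Definition source_component (n : nat) (F : {set 'I_n})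
    (H : {set 'I_n * 'I_n}) : {set 'I_n} :=
  [set i | (i \notin F) &&
     [forall (j | j \notin F), connect (fun k l => (k, l) \in H) i j]]%SET.

(** The source component is by definition a nonempty collection: "containing
    one" means that the set above is not empty. *)
Definition assumption1 (n : nat) (e : rel 'I_n) (f : nat) : Prop :=
  forall (F : {set 'I_n}) (H : {set 'I_n * 'I_n}),
    (#|F| <= f)%N -> reduced_graph e f F H -> source_component F H != finset.set0.

(** Functions on a closed convex set X are represented by total functions whose
    values outside X are never used. *)

Definition argmin (R : realType) (X : set R) (p : R -> R) : set R :=
  [set x | X x /\ forall y, X y -> p x <= p y].

(** [dh] is the derivative of [h] relative to X, hence one-sided at an end
    point of X; it is unique on X unless X is a single point. *)
Definition derivative_on (R : realType) (X : set R) (h dh : R -> R) : Prop :=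
  forall x, X x ->
    (h y - h x) / (y - x) @[y --> within X x^'] --> dh x.

Definition admissible (R : realType) (X : set R) (L : R) (h dh : R -> R) :
    Prop :=
  [/\ @convex_function R R^o X h,
      derivative_on X h dh /\ {within X, continuous dh},
      L.-lipschitz_X dh,
      (forall x, X x -> `|dh x| <= L) &
      argmin X h !=set0 /\ compact (argmin X h)].

Definition proj (R : realType) (X : set R) (y : R) : R :=
  get [set z | X z /\ forall u, X u -> `|y - z| <= `|y - u|].

(** Extended-real valued, so that the distance to the empty set is +oo (the
    real-valued [inf] of the empty set is 0). *)
Definition dist_to (R : realType) (x : R) (S : set R) : \bar R :=
  ereal_inf [set (`|x - y|)%:E | y in S].

Definition valid_functions (R : realType) (n : nat) (h : 'I_n -> R -> R)
    (F : {set 'I_n}) (beta : R) (gamma : nat) : set (R -> R) :=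
  [set p | exists alpha : 'I_n -> R,
     [/\ forall i, i \notin F -> 0 <= alpha i,
         \sum_(i | i \notin F) alpha i = 1,
         (gamma <= #|[set i | (i \notin F) && (beta <= alpha i)%R]%SET|)%N &
         p = (fun x => \sum_(i | i \notin F) alpha i * h i x)]].

Definition valid_optima (R : realType) (n : nat) (X : set R)
    (h : 'I_n -> R -> R) (F : {set 'I_n}) (beta : R) (gamma : nat) : set R :=
  \bigcup_(p in valid_functions h F beta gamma) argmin X p.

Definition stepsizes (R : realType) (lambda : R^nat) : Prop :=
  [/\ forall t, 0 < lambda t,
      forall t, lambda t.+1 <= lambda t,
      series lambda @ \oo --> +oo &
      cvgn (series (fun t => lambda t ^+ 2))].

(** K is a possible set of senders left after sorting the values [v j], for j
    in I, and discarding the first f and the last f of the sorted list; the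
    choice of the sorted enumeration [s] is the tie-breaking. *)
Definition trimmed (R : realType) (n : nat) (f : nat) (v : 'I_n -> R)
    (I K : {set 'I_n}) : Prop :=
  exists s : seq 'I_n,
    [/\ perm_eq s (enum I),
        sorted (fun j k => v j <= v k) s &
        K = [set j in take (size s - 2 * f)%N (drop f s)]%SET].

(** [x i t] is the state of agent i after t iterations, and [w t i j] the value
    that agent i holds for its in-neighbor j in iteration t + 1.  Since w
    depends on the receiver, and is unconstrained when the sender j is faulty,
    it covers arbitrary inconsistent messages as well as the default values
    replacing missing messages.  The states of faulty agents after time 0 are
    unconstrained. *)
Definition execution (R : realType) (n : nat) (e : rel 'I_n) (f : nat)
    (F : {set 'I_n}) (X : set R) (dh : 'I_n -> R -> R) (lambda : R^nat)
    (x : 'I_n -> R^nat) (w : nat -> 'I_n -> 'I_n -> R) : Prop :=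
  [/\ forall i, X (x i 0%N),
      forall t i j, i \notin F -> j \notin F -> e j i -> w t i j = x j t &
      forall t i, i \notin F ->
        exists K : {set 'I_n},
          trimmed f (w t i) (in_nbrs e i) K /\
          x i t.+1 =
            proj X (((in_degree e i)%:R + 1 - 2 * f%:R)^-1
                      * (x i t + \sum_(j in K) w t i j)
                    - lambda t * dh i (x i t))].

(* Main.v *)
Require Import Defs.
From mathcomp Require Import ring lra zify.
Local Open Scope classical_set_scope.
Local Open Scope ring_scope.

(** Let m be the number of non-faulty agents and tau that of reduced graphs.
    A trimmed mean is an average of values of non-faulty agents in which the
    agent itself and its in-neighbors in some reduced graph get a weight bounded
    below. Among tau * m successive steps some reduced graph occurs m times, so
    that over such a block each agent of its source component acquires a weight
    of at least b := 1 / (2 A)^(tau m), with A := d_max + 1 - 2 f, on every agent.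
    When fewer than f in-neighbors of an agent are faulty, a single edge can get
    less than 1 / (2 A); but all except m of the tau * m steps use a self-loop,
    whose weight is at least 1 / A, so that each edge may be as light as
    2^-tau / A.

    Hence the blocks contract the spread of the states, which gives consensus,
    and the rows of the products of at least tau * m matrices are the weights of
    functions in A(b, gamma). Let z0 be a point above all valid optima. By
    convexity the derivatives at z0 of all functions in A(b, gamma) exceed some
    kappa > 0. While all states stay above z0, unrolling the recursion shows that
    the gradient step of time t contributes at most - kappa * lambda[t] to all
    states after time t + tau * m, and the steps of the last block are negligible;
    as the stepsizes have an infinite sum, the states must come down to z0, and they
    can never again rise significantly above it. The mirror image of this
    argument bounds the states from below, and the set of valid optima is an
    interval. *)

(** * Averaging dynamics *)

Definition stochastic (R : realType) (n : nat) (A : 'M[R]_n) : Prop :=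
  (forall i j, 0 <= A i j) /\ (forall i, \sum_j A i j = 1).

Definition average (R : realType) (n : nat) (A : 'M[R]_n) (v : 'I_n -> R)
    (i : 'I_n) : R := \sum_j A i j * v j.

(** The product of [M t] up to [M (t + d - 1)], the latest factor on the left; it moves averages
    from time t to time t + d. *)
Fixpoint transition (R : realType) (n : nat) (M : nat -> 'M[R]_n)
    (d t : nat) : 'M[R]_n :=
  if d is d'.+1 then transition M d' t.+1 *m M t else 1%:M.

Section Averages.
Variables (R : realType) (n : nat).
Implicit Types (A B : 'M[R]_n) (u v : 'I_n -> R).

Lemma stochastic1 : stochastic (1%:M : 'M[R]_n).
Proof.
split=> [i j|i]; first by rewrite mxE ler0n.
rewrite (bigD1 i) //= big1 ?addr0 ?mxE ?eqxx // => j ji.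
by rewrite mxE eq_sym (negbTE ji).
Qed.

Lemma average_mulmx A B v i : average (A *m B) v i = average A (average B v) i.
Proof.
rewrite /average; under eq_bigr do rewrite mxE mulr_suml.
rewrite exchange_big /=; apply: eq_bigr => k _; rewrite mulr_sumr.
by apply: eq_bigr => j _; rewrite mulrA.
Qed.

Lemma average1 v i : average 1%:M v i = v i.
Proof.
rewrite /average (bigD1 i) //= big1 => [|j ji].
  by rewrite addr0 mxE eqxx mul1r.
by rewrite mxE eq_sym (negbTE ji) mul0r.
Qed.

Lemma averageB A u v i :
  average A (fun j => u j - v j) i = average A u i - average A v i.
Proof. by rewrite -sumrB; apply: eq_bigr => j _; rewrite mulrBr. Qed.

Lemma averageN A v i : average A (fun j => - v j) i = - average A v i.
Proof. by rewrite -sumrN; apply: eq_bigr => j _; rewrite mulrN. Qed.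

Lemma averageZ A c v i : average A (fun j => c * v j) i = c * average A v i.
Proof. by rewrite mulr_sumr; apply: eq_bigr => j _; rewrite mulrCA. Qed.

Lemma ler_average A u v i : stochastic A -> (forall j, u j <= v j) ->
  average A u i <= average A v i.
Proof. by case=> A0 _ uv; apply: ler_sum => j _; rewrite ler_wpM2l. Qed.

Lemma average_cst A c i : stochastic A -> average A (fun=> c) i = c.
Proof. by case=> _ A1; rewrite /average -mulr_suml A1 mul1r. Qed.

Lemma average_le A v c i : stochastic A -> (forall j, v j <= c) ->
  average A v i <= c.
Proof.
by move=> sA vc; rewrite -[leRHS](average_cst c i sA); exact: ler_average.
Qed.

Lemma average_ge A v c i : stochastic A -> (forall j, c <= v j) ->
  c <= average A v i.
Proof.
by move=> sA vc; rewrite -[leLHS](average_cst c i sA); exact: ler_average.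
Qed.

Lemma stochasticM A B : stochastic A -> stochastic B -> stochastic (A *m B).
Proof.
move=> sA sB; split=> [i j|i].
  by rewrite mxE sumr_ge0 // => k _; rewrite mulr_ge0 // ?sA.1 ?sB.1.
have -> : \sum_j (A *m B) i j = average (A *m B) (fun=> 1) i.
  by apply: eq_bigr => j _; rewrite mulr1.
rewrite average_mulmx -[RHS](average_cst 1 i sA); apply: eq_bigr => j _.
by rewrite average_cst.
Qed.

(** The mass b that both rows put on s cancels in the difference; the rest of each row has mass 1 -
    b and averages values between lo and hi. *)
Lemma average_contract A v b s lo hi i j : stochastic A ->
  (forall k, lo <= v k <= hi) -> b <= A i s -> b <= A j s ->
  average A v i - average A v j <= (1 - b) * (hi - lo).
Proof.
move=> [A0 A1] vb bi bj.
have mass k : \sum_(l | l != s) A k l = 1 - A k s.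
  by rewrite -(A1 k) [in RHS](bigD1 s) //= addrAC subrr add0r.
have up : average A v i <= A i s * v s + (1 - A i s) * hi.
  rewrite /average (bigD1 s) //= lerD2l -mass mulr_suml; apply: ler_sum => k _.
  by rewrite ler_wpM2l //; case/andP: (vb k).
have dn : A j s * v s + (1 - A j s) * lo <= average A v j.
  rewrite /average (bigD1 s) //= lerD2l -mass mulr_suml; apply: ler_sum => k _.
  by rewrite ler_wpM2l //; case/andP: (vb k).
have /andP[vl vh] := vb s.
have : (A i s - b) * (hi - v s) >= 0 by rewrite mulr_ge0 ?subr_ge0.
have : (A j s - b) * (v s - lo) >= 0 by rewrite mulr_ge0 ?subr_ge0.
by nra.
Qed.

End Averages.

Section Transition.
Variables (R : realType) (n : nat) (M : nat -> 'M[R]_n).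
Hypothesis M_stoch : forall t, stochastic (M t).

Lemma transition_stochastic d t : stochastic (transition M d t).
Proof.
by elim: d t => [|d IHd] t /=; [exact: stochastic1|exact: stochasticM].
Qed.

Lemma transitionD c d t :
  transition M (c + d) t = transition M c (t + d) *m transition M d t.
Proof.
elim: d t => [|d IHd] t /=; first by rewrite !addn0 mulmx1.
by rewrite addnS /= IHd addSnnS mulmxA.
Qed.

Lemma transitionS d t :
  transition M d.+1 t = M (t + d)%N *m transition M d t.
Proof. by rewrite -(add1n d) transitionD /= mul1mx. Qed.

(** A stochastic left factor replaces the entries of each column by averages of them, so a lower
    bound on a column survives all later steps. *)
Lemma transition_ge_col c d t s b :
  (forall j, b <= transition M d t j s) ->
  forall i, b <= transition M (c + d) t i s.
Proof.
move=> bs i; rewrite transitionD mxE.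
exact: (average_ge (v := fun j => transition M d t j s) i
  (transition_stochastic c (t + d))).
Qed.

End Transition.

(** * Perturbed averaging and consensus *)

Section Dynamics.
Variables (R : realType) (n : nat) (M : nat -> 'M[R]_n).
Variables (lambda : R^nat) (x : 'I_n -> R^nat) (L : R) (B : nat).
Hypothesis M_stoch : forall t, stochastic (M t).
Hypothesis lambda_gt0 : forall t, 0 < lambda t.
Hypothesis lambda_noninc : forall t, lambda t.+1 <= lambda t.
Hypothesis lambda_to0 : forall eps, 0 < eps ->
  exists T, forall t, (T <= t)%N -> lambda t <= eps.
Hypothesis L_ge0 : 0 <= L.
Hypothesis step_close :
  forall t i, `|x i t.+1 - average (M t) (x^~ t) i| <= L * lambda t.

Lemma lambda_le s t : (s <= t)%N -> lambda t <= lambda s.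
Proof.
by elim: t => [|t IHt]; rewrite leq_eqVlt => /predU1P[->|] // /IHt; apply: le_trans.
Qed.

(** Stochastic matrices do not amplify perturbations in the sup norm, and each of the d
    perturbations is at most [L * lambda t], as the stepsizes do not increase. *)
Lemma unrolled_close d t i :
  `|x i (t + d)%N - average (transition M d t) (x^~ t) i| <= L * lambda t * d%:R.
Proof.
elim: d t i => [|d IHd] t i; first by rewrite addn0 average1 subrr normr0 mulr0.
rewrite /= average_mulmx addnS -addSn.
set W := transition M d t.+1; have sW : stochastic W by exact: transition_stochastic.
have dist : `|average W (x^~ t.+1) i - average W (average (M t) (x^~ t)) i|
    <= L * lambda t.
  rewrite -averageB ler_norml; apply/andP; split.
    by apply: average_ge => // j; have := step_close t j; rewrite ler_norml => /andP[].
  by apply: average_le => // j; have := step_close t j; rewrite ler_norml => /andP[].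
have := IHd t.+1 i; rewrite -/W => IH.
have : L * lambda t.+1 * d%:R <= L * lambda t * d%:R.
  by rewrite ler_wpM2r ?ler0n // ler_wpM2l.
have := ler_distD (average W (x^~ t.+1) i) (x i (t.+1 + d)%N)
  (average W (average (M t) (x^~ t)) i).
by rewrite -natr1 mulrDr mulr1; lra.
Qed.

Section Consensus.
Variable b : R.
Hypothesis B_gt0 : (0 < B)%N.
Hypothesis b_gt0 : 0 < b.
Hypothesis common_source :
  forall t, exists s, forall i, b <= transition M B t i s.

Lemma exists_extrema (v : 'I_n -> R) : 'I_n ->
  exists lo hi : 'I_n, forall k, v lo <= v k <= v hi.
Proof.
move=> i0; exists [arg min_(k < i0) v k]%O, [arg max_(k > i0) v k]%O => k.
apply/andP; split; first by case: arg_minP => // l _ ->.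
by case: arg_maxP => // l _; apply.
Qed.

Let spread t : R := \sum_(p : 'I_n * 'I_n) `|x p.1 t - x p.2 t|.

(** A block of B steps turns a spread D into at most (1 - b) D plus an error that vanishes with the
    stepsizes, so the spread decays geometrically from block to block. *)
Lemma consensus eps : 0 < eps ->
  exists T, forall t, (T <= t)%N -> forall i j, `|x i t - x j t| <= eps.
Proof.
move=> e0; have [n0|n_gt0] := posnP n.
  by exists 0%N => t _ i; have := ltn_ord i; rewrite [X in (_ < X)%N]n0.
have b1 : b <= 1.
  have [s /(_ (Ordinal n_gt0)) bs] := common_source 0.
  apply: le_trans bs _; have [W0 W1] := transition_stochastic M_stoch B 0.
  rewrite -(W1 (Ordinal n_gt0)) (bigD1 s) //= lerDl; exact: sumr_ge0.
(* Each of two states deviates from its average by at most [L * lambda t * B]. Bounding the sum by b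
   eps/2 makes eps/2 the fixed point of D -> (1 - b) D + b eps/2. *)
pose C := 2 * (L * B%:R).
have C0 : 0 <= C by rewrite /C mulr_ge0 ?mulr_ge0.
have [K1 lamK] : exists T, forall t, (T <= t)%N -> C * lambda t <= b * (eps / 2).
  have [|T HT] := lambda_to0 (eps := b * (eps / 2) / (C + 1)).
    by rewrite !mulr_gt0 // ?invr_gt0; lra.
  exists T => t /HT; rewrite ler_pdivlMr; last lra.
  by have := lambda_gt0 t; nra.
have contract t D : (forall i j, `|x i t - x j t| <= D) -> (K1 <= t)%N ->
    forall i j, `|x i (t + B)%N - x j (t + B)%N| <= (1 - b) * D + b * (eps / 2).
  move=> xD Kt.
  have [lo [hi lohi]] := exists_extrema (x^~ t) (Ordinal n_gt0).
  have [s bs] := common_source t.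
  have half i j : x i (t + B)%N - x j (t + B)%N <= (1 - b) * D + b * (eps / 2).
    have := average_contract (transition_stochastic M_stoch B t) lohi (bs i) (bs j).
    have : (1 - b) * (x hi t - x lo t) <= (1 - b) * D.
      rewrite ler_wpM2l ?subr_ge0 //; exact: le_trans (ler_norm _) (xD _ _).
    have := unrolled_close B t i; have := unrolled_close B t j.
    rewrite !ler_norml => /andP[? ?] /andP[? ?].
    by have := lamK t Kt; rewrite /C; lra.
  move=> i j; rewrite ler_norml half andbT lerNl opprB; exact: half.
pose D0 := \sum_(r < B) spread (K1 + r)%N.
have spread_ge t i j : `|x i t - x j t| <= spread t.
  by rewrite /spread (bigD1 (i, j)) //= lerDl sumr_ge0.
have D0P t i j : (K1 <= t < K1 + B)%N -> `|x i t - x j t| <= D0.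
  move=> /andP[Kt tK]; have tB : (t - K1 < B)%N by lia.
  apply: le_trans (spread_ge t i j) _; rewrite /D0 (bigD1 (Ordinal tB)) //= subnKC //.
  by rewrite lerDl; apply: sumr_ge0 => r _; apply: sumr_ge0.
have decay q t i j : (K1 + q * B <= t < K1 + q.+1 * B)%N ->
    `|x i t - x j t| <= (1 - b) ^+ q * D0 + eps / 2.
  elim: q t i j => [|q IHq] t i j tq.
    have /(_ _)/le_trans -> // := D0P t i j; first by lia.
    by rewrite expr0 mul1r; lra.
  have tB : t = (t - B + B)%N by lia.
  have IH k l : `|x k (t - B)%N - x l (t - B)%N| <= (1 - b) ^+ q * D0 + eps / 2.
    by apply: IHq; lia.
  have Kt : (K1 <= t - B)%N by lia.
  by have := contract _ _ IH Kt i j; rewrite -tB exprS; nra.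
have [q qP] : exists q, (1 - b) ^+ q * D0 <= eps / 2.
  have D00 : 0 <= D0 by apply: sumr_ge0 => r _; apply: sumr_ge0.
  have : (1 - b) ^+ k @[k --> \oo] --> (0 : R).
    by apply: cvg_expr; rewrite ger0_norm ?subr_ge0 // ltrBlDr ltrDl.
  have e1 : 0 < eps / 2 / (D0 + 1) by rewrite !divr_gt0 //; lra.
  move=> /cvgrPdist_le /(_ _ e1) [q _ /(_ q (leqnn q))].
  have q0 : 0 <= (1 - b) ^+ q by apply: exprn_ge0; lra.
  rewrite /= sub0r normrN ger0_norm // ler_pdivlMr => [h|]; last lra.
  by exists q; lra.
exists (K1 + q * B)%N => t tq i j.
have := decay ((t - K1) %/ B)%N t i j.
have -> : (K1 + (t - K1) %/ B * B <= t < K1 + ((t - K1) %/ B).+1 * B)%N.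
  by have := leq_trunc_div (t - K1) B; have := ltn_ceil (t - K1) B_gt0; lia.
move=> /(_ isT) h; apply: le_trans h _.
have qd : (q <= (t - K1) %/ B)%N by rewrite leq_divRL //; lia.
have D00 : 0 <= D0 by apply: sumr_ge0 => r _; apply: sumr_ge0.
have : (1 - b) ^+ ((t - K1) %/ B) <= (1 - b) ^+ q.
  by apply: ler_wiXn2l => //; rewrite ?subr_ge0 // gerBl ltW.
by nra.
Qed.

End Consensus.
End Dynamics.

(** * Descent to a level with positive averaged gradients *)

Section Descent.
Variables (R : realType) (n : nat) (M : nat -> 'M[R]_n).
Variables (lambda : R^nat) (x g : 'I_n -> R^nat) (L : R) (B : nat).
Variables (y0 z0 kappa : R).
Hypothesis M_stoch : forall t, stochastic (M t).
Hypothesis lambda_gt0 : forall t, 0 < lambda t.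
Hypothesis lambda_noninc : forall t, lambda t.+1 <= lambda t.
Hypothesis lambda_to0 : forall eps, 0 < eps ->
  exists T, forall t, (T <= t)%N -> lambda t <= eps.
Hypothesis lambda_sum : forall T A, exists q, A <= \sum_(u < q) lambda (T + u)%N.
Hypothesis L_ge0 : 0 <= L.
Hypothesis step_close :
  forall t i, `|x i t.+1 - average (M t) (x^~ t) i| <= L * lambda t.
Hypothesis step_le : forall t i,
  x i t.+1 <= Num.max (average (M t) (x^~ t) i - lambda t * g i t) y0.
Hypothesis consensus_x : forall eps, 0 < eps ->
  exists T, forall t, (T <= t)%N -> forall i j, `|x i t - x j t| <= eps.
Hypothesis y0_lt : y0 < z0.
Hypothesis kappa_gt0 : 0 < kappa.
Hypothesis drift : forall t, (forall j, z0 <= x j t) ->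
  forall d s i, (B <= d)%N -> kappa <= average (transition M d s) (g^~ t) i.

(** Unrolled from the first step: the gradient of each of the first q times passes through at least
    B later matrices, so that [drift] applies to it; the last B steps are only bounded by their
    size. *)
Lemma segment_descent q t i :
  (forall u j, (t <= u <= t + q)%N -> z0 <= x j u) ->
  x i (t + (q + B))%N <= average (transition M (q + B) t) (x^~ t) i
    + L * lambda t * B%:R - kappa * \sum_(u < q) lambda (t + u)%N.
Proof.
elim: q t => [|q IHq] t above.
  rewrite big_ord0 mulr0 subr0 add0n.
  have := unrolled_close M_stoch lambda_noninc L_ge0 step_close B t i.
  by rewrite ler_norml => /andP[_]; lra.
rewrite addSn addnS -addSn /= average_mulmx.
set W := transition M (q + B) t.+1.
have sW : stochastic W by exact: transition_stochastic.
have IH := IHq t.+1; rewrite -/W in IH.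
have {IH} := IH _; rewrite big_ord_recl addn0.
under [in X in X -> _]eq_bigr do rewrite addSnnS; rewrite /=.
under [in X in _ -> X]eq_bigr do rewrite /bump /= add1n.
move=> /(_ _)/le_trans -> //.
  by move=> u j /andP[tu ut]; apply: above; lia.
have WM : average W (x^~ t.+1) i <=
    average W (average (M t) (x^~ t)) i - lambda t * kappa.
  have : average W (x^~ t.+1) i <=
      average W (fun j => average (M t) (x^~ t) j - lambda t * g j t) i.
    apply: ler_average => // j.
    (* The other branch of the maximum, a state at most [y0], contradicts [y0 < z0]. *)
    have := step_le t j; rewrite le_max => /orP[//|].
    have : z0 <= x j t.+1 by apply: above; lia.
    by move: y0_lt; lra.
  move/le_trans; apply; rewrite averageB averageZ lerD2l lerN2 ler_pM2l //.
  by apply: drift; [move=> j; apply: above; lia|exact: leq_addl].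
have : L * lambda t.+1 * B%:R <= L * lambda t * B%:R.
  by rewrite ler_wpM2r ?ler0n // ler_wpM2l.
by rewrite mulrDr; move: WM; lra.
Qed.

(** Some late time is low, since otherwise the divergent sum of stepsizes would drive the states to
    minus infinity. After the last low time before T, the states gain at most eps/3 in the step that
    leaves the low range and eps/3 in the last B steps; the gradients in between only pull down. *)
Lemma eventually_le eps : 0 < eps ->
  exists T, forall t, (T <= t)%N -> forall i, x i t <= z0 + eps.
Proof.
move=> e0; have e3 : 0 < eps / 3 by lra.
have [T1 cons] := consensus_x e3.
have [T2 small] : exists T, forall t, (T <= t)%N ->
    forall d, (d <= B.+1)%N -> L * lambda t * d%:R <= eps / 3.
  have [|T HT] := lambda_to0 (eps := eps / 3 / (L * B.+1%:R + 1)).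
    by rewrite !divr_gt0 // ltr_wpDl // mulr_ge0.
  exists T => t /HT; rewrite ler_pdivlMr ?ltr_wpDl ?mulr_ge0 // => h d dB.
  apply: le_trans h; rewrite mulrDr mulr1 mulrCA mulrA.
  have : L * lambda t * d%:R <= L * lambda t * B.+1%:R.
    by rewrite ler_wpM2l ?ler_nat // mulr_ge0 // ltW.
  by have := lambda_gt0 t; lra.
pose low t := forall i, x i t <= z0 + eps / 3.
(* With a spread of at most eps/3, one state above [z0 + eps / 3] keeps all states above [z0]. *)
have high t : (T1 <= t)%N -> ~ low t -> forall j, z0 <= x j t.
  move=> Tt /existsNP[i /negP]; rewrite -ltNge => xi j.
  by have := cons t Tt i j; rewrite ler_norml => /andP[_]; lra.
pose T0 := maxn T1 T2.
have [t1 T0t1 low1] : exists2 t, (T0 <= t)%N & low t.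
  apply: contrapT => noL.
  have above u j : (T0 <= u)%N -> z0 <= x j u.
    move=> Tu; apply: high => [|lu]; first by rewrite (leq_trans _ Tu) ?leq_maxl.
    by apply: noL; exists u.
  have [n0|n_gt0] := posnP n.
    apply: noL; exists T0 => // i; have := ltn_ord i.
    by rewrite [X in (_ < X)%N]n0.
  pose i0 := Ordinal n_gt0.
  have [q qP] := lambda_sum T0 ((x i0 T0 + eps - z0) / kappa).
  have : z0 <= x i0 (T0 + (q + B))%N by apply: above; rewrite leq_addr.
  have := @segment_descent q T0 i0 (fun u j tu => above u j (proj1 (andP tu))).
  have : average (transition M (q + B) T0) (x^~ T0) i0 <= x i0 T0 + eps / 3.
    apply: average_le; first exact: transition_stochastic.
    move=> j; have := cons T0 (leq_maxl _ _) j i0.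
    by rewrite ler_norml => /andP[_]; lra.
  have := small T0 (leq_maxr _ _) B (leqnSn B).
  rewrite ler_pdivrMr // mulrC in qP.
  by move: e0; lra.
exists t1 => T t1T i.
have [t0 [t10 t0T low0 after]] : exists t0, [/\ (t1 <= t0)%N, (t0 <= T)%N, low t0 &
    forall u, (t0 < u <= T)%N -> ~ low u].
  elim: T t1T => [|T IHT] t1T.
    by exists 0%N; split=> //; [by move: low1; have -> : t1 = 0%N by lia|lia].
  have [lT|nlT] := pselect (low T.+1).
    by exists T.+1; split=> //; lia.
  have t1T' : (t1 <= T)%N.
    rewrite -ltnS ltn_neqAle t1T andbT; apply/eqP => tE.
    by apply: nlT; rewrite -tE.
  have [t0 [? ? ? after]] := IHT t1T'; exists t0; split=> //; first by lia.
  move=> u /andP[tu]; rewrite leq_eqVlt => /predU1P[->//|uT].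
  by apply: after; rewrite tu.
have [t0E|t0T'] := eqVneq t0 T.
  by have := low0 i; rewrite t0E; lra.
have {t0T t0T'} t0T : (t0.+1 <= T)%N by rewrite ltn_neqAle t0T'.
have T1t0 : (T1 <= t0)%N by rewrite (leq_trans _ t10) // (leq_trans _ T0t1) ?leq_maxl.
have T2t0 : (T2 <= t0)%N by rewrite (leq_trans _ t10) // (leq_trans _ T0t1) ?leq_maxr.
have start j : x j t0.+1 <= z0 + eps / 3 + eps / 3.
  have := step_close t0 j; rewrite ler_norml => /andP[_].
  have := average_le j (M_stoch t0) low0.
  by have := small t0 T2t0 1%N isT; rewrite mulr1; lra.
have above u j : (t0 < u <= T)%N -> z0 <= x j u.
  by move=> tu; apply: high; [lia|exact: after].
have startW d : average (transition M d t0.+1) (x^~ t0.+1) i <= z0 + eps / 3 + eps / 3.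
  by apply: average_le => //; exact: transition_stochastic.
have small' d := small t0.+1 (leqW T2t0) d.
have [dB|Bd] := ltnP (T - t0.+1) B.
  have := unrolled_close M_stoch lambda_noninc L_ge0 step_close (T - t0.+1) t0.+1 i.
  rewrite subnKC // ler_norml => /andP[_].
  have := small' (T - t0.+1)%N; have := startW (T - t0.+1)%N.
  by move=> h1 /(_ _)/[swap] h2 /(_ (leqW (ltnW dB))); lra.
have := @segment_descent (T - t0.+1 - B) t0.+1 i.
rewrite subnK // subnKC // => /(_ _)/le_trans -> //.
  by move=> u j ut; apply: above; lia.
have := small' B (leqnSn B); have := startW (T - t0.+1)%N.
have : 0 <= kappa * \sum_(u < T - t0.+1 - B) lambda (t0.+1 + u)%N.
  by rewrite mulr_ge0 ?(ltW kappa_gt0) // sumr_ge0 // => u _; exact: ltW.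
by lra.
Qed.

End Descent.

Section Approach.
Variables (R : realType) (n : nat) (M : nat -> 'M[R]_n).
Variables (lambda : R^nat) (x g : 'I_n -> R^nat) (L : R) (B : nat).
Variables (Y : set R) (y0 : R).
Hypothesis M_stoch : forall t, stochastic (M t).
Hypothesis lambda_gt0 : forall t, 0 < lambda t.
Hypothesis lambda_noninc : forall t, lambda t.+1 <= lambda t.
Hypothesis lambda_to0 : forall eps, 0 < eps ->
  exists T, forall t, (T <= t)%N -> lambda t <= eps.
Hypothesis lambda_sum : forall T A, exists q, A <= \sum_(u < q) lambda (T + u)%N.
Hypothesis L_ge0 : 0 <= L.
Hypothesis step_close :
  forall t i, `|x i t.+1 - average (M t) (x^~ t) i| <= L * lambda t.
Hypothesis step_le : forall t i,
  x i t.+1 <= Num.max (average (M t) (x^~ t) i - lambda t * g i t) y0.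
Hypothesis consensus_x : forall eps, 0 < eps ->
  exists T, forall t, (T <= t)%N -> forall i j, `|x i t - x j t| <= eps.
Hypothesis Y_y0 : Y y0.
Hypothesis drift : forall z0, (forall y, Y y -> y < z0) ->
  exists2 kappa, 0 < kappa & forall t, (forall j, z0 <= x j t) ->
    forall d s i, (B <= d)%N -> kappa <= average (transition M d s) (g^~ t) i.

(** If Y is unbounded above, some point of Y exceeds any given state. Otherwise the descent is
    applied to the level [sup Y + eps / 3], and a point of Y within eps/3 of the supremum is
    taken. *)
Lemma eventually_le_near eps : 0 < eps ->
  exists T, forall t, (T <= t)%N -> forall i, exists2 y, Y y & x i t <= y + eps.
Proof.
move=> e0; have [Yb|Yb] := pselect (has_ubound Y); last first.
  exists 0%N => t _ i; apply: contrapT => noy; apply: Yb; exists (x i t) => y Yy.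
  rewrite leNgt; apply/negP => xy; apply: noy; exists y => //.
  by move: xy e0; lra.
have Ys : has_sup Y by split=> //; exists y0.
have e3 : 0 < eps / 3 by lra.
have lt_z0 y : Y y -> y < sup Y + eps / 3.
  by move=> Yy; have := ub_le_sup Yb Yy; lra.
have [kappa kappa0 dr] := drift lt_z0.
have [T HT] := eventually_le M_stoch lambda_gt0 lambda_noninc lambda_to0 lambda_sum
  L_ge0 step_close step_le consensus_x (lt_z0 _ Y_y0) kappa0 dr e3.
exists T => t Tt i; have [y Yy ylt] := sup_adherent e3 Ys.
by exists y => //; have := HT t Tt i; lra.
Qed.

End Approach.

(** * Convex functions on an interval and projections *)

Lemma interpolation (R : realType) (a b c : R) : a <= c <= b ->
  exists2 t, 0 <= t <= 1 & c = t * a + (1 - t) * b.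
Proof.
move=> /andP[ac cb]; have [ab|ab] := eqVneq a b.
  by exists 0; rewrite ?lexx ?ler01 //; lra.
have ab0 : 0 < b - a by rewrite subr_gt0 lt_neqAle ab (le_trans ac).
exists ((b - c) / (b - a)).
  apply/andP; split; last by rewrite ler_pdivrMr // mul1r; lra.
  by rewrite divr_ge0 ?subr_ge0 // -subr_ge0 ltW.
by field; rewrite gt_eqF.
Qed.

Section ConvexAnalysis.
Variable R : realType.
Implicit Types (X : set R) (h dh : R -> R).

Definition interval_like X := forall a b c, X a -> X b -> a <= c <= b -> X c.

Definition subgradient_on X h dh :=
  forall z y, X z -> X y -> h z + dh z * (y - z) <= h y.

Lemma convex_set_interval X : @convex_set R R^o X -> interval_like X.
Proof.
move=> cX a b c Xa Xb /interpolation[t /andP[t0 t1] ->].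
by have := cX a b (Itv01 t0 t1); rewrite !inE => /(_ Xa Xb).
Qed.

(** By convexity, the difference quotient from z to a point of the segment towards y, times y - z,
    is at most [h y - h z]; near z it is close to [dh z]. *)
Lemma convex_subgradient X h dh : @convex_set R R^o X ->
  @convex_function R R^o X h -> derivative_on X h dh -> subgradient_on X h dh.
Proof.
move=> cX ch dhP z y Xz Xy; have itvX := convex_set_interval cX.
have [->|yz] := eqVneq y z; first by rewrite subrr mulr0 addr0.
have conv_le (t : R) : 0 < t -> t <= 1 ->
    h (z + t * (y - z)) <= h z + t * (h y - h z).
  move=> t0 t1; have := ch (Itv01 (ltW t0) t1) y z.
  rewrite !inE => /(_ Xy Xz) h1.
  have {}h1 : h (t * y + (1 - t) * z) <= t * h y + (1 - t) * h z by exact: h1.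
  have -> : z + t * (y - z) = t * y + (1 - t) * z by ring.
  by apply: le_trans h1 _; lra.
apply/ler_addgt0Pl => e e0.
have yz0 : 0 < `|y - z| by rewrite normr_gt0 subr_eq0.
have e1 : 0 < e / `|y - z| by rewrite divr_gt0.
have /cvgrPdist_le/(_ _ e1) := dhP z Xz.
rewrite near_withinE => /nbhs_ballP[r /= r0 rP].
pose t := Num.min 1 (r / 2 / `|y - z|).
have t0 : 0 < t by rewrite lt_min ltr01 !divr_gt0.
have t1 : t <= 1 by rewrite ge_min lexx.
have tr : t * `|y - z| < r.
  have : t * `|y - z| <= r / 2 by rewrite -ler_pdivlMr // ge_min lexx orbT.
  by move: r0; lra.
pose c := z + t * (y - z).
have Xc : X c.
  have [zy|zy] := leP z y; [apply: (itvX z y) => //|apply: (itvX y z) => //];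
  by rewrite /c; apply/andP; split; nra.
have cz : c - z = t * (y - z) by rewrite /c; ring.
have cz0 : c - z != 0 by rewrite cz mulf_neq0 ?subr_eq0 // (gt_eqF t0).
have := rP c; rewrite /= -ball_normE /= distrC cz normrM gtr0_norm // => /(_ tr).
move=> /(_ _ Xc); rewrite -subr_eq0 cz0 => /(_ isT).
rewrite -cz => h1.
have h2 := conv_le t t0 t1; rewrite -/c in h2.
have h3 : (h c - h z) / (c - z) * (y - z) <= h y - h z.
  have -> : (h c - h z) / (c - z) * (y - z) = (h c - h z) / t.
    by rewrite cz; field; rewrite subr_eq0 yz (gt_eqF t0).
  by rewrite ler_pdivrMr //; lra.
have : `|(dh z - (h c - h z) / (c - z)) * (y - z)| <= e.
  by rewrite normrM -ler_pdivlMr.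
by rewrite ler_norml => /andP[_]; lra.
Qed.

Lemma subgradient_monotone X h dh a c :
  subgradient_on X h dh -> X a -> X c -> a <= c -> dh a <= dh c.
Proof.
move=> hsub Xa Xc ac; have [->//|ne] := eqVneq a c.
have lt_ac : 0 < c - a by rewrite subr_gt0 lt_neqAle ne.
rewrite -(ler_pM2r lt_ac); have := hsub _ _ Xa Xc; have := hsub _ _ Xc Xa; lra.
Qed.

Lemma lipschitz_within (k : R) (A : set R) (f : R -> R) :
  (forall x y, A x -> A y -> `|f x - f y| <= k * `|x - y|) ->
  {within A, continuous f}.
Proof.
move=> f_lip; apply/subspace_continuousP => x Ax; apply/cvgrPdist_le => e e0.
have k1 : 0 < `|k| + 1 by rewrite ltr_wpDl.
rewrite near_withinE; apply/nbhs_ballP; exists (e / (`|k| + 1)) => /=.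
  by rewrite divr_gt0.
move=> y; rewrite /ball /= ltr_pdivlMr // => xy Ay; apply: le_trans (f_lip _ _ Ax Ay) _.
by have := ler_norm k; have := normr_ge0 (x - y); nra.
Qed.

(** [proj] is a choice, so a nearest point must be exhibited: it is sought in the compact part of X
    that is no farther from v than a. *)
Lemma proj_nearest X v : closed X -> X !=set0 ->
  X (proj X v) /\ forall u, X u -> `|v - proj X v| <= `|v - u|.
Proof.
move=> Xcl [a Xa]; apply: (@getPex _ [set z | X z /\ forall u, X u -> `|v - z| <= `|v - u|]).
pose K := X `&` `[v - `|v - a|, v + `|v - a|]%classic.
have cK : compact K.
  apply: (@subclosed_compact _ _ `[v - `|v - a|, v + `|v - a|]%classic).
  - by apply: closedI => //; exact: interval_closed.
  - exact: segment_compact.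
  - by move=> ? [].
have aK : K a.
  split=> //=; rewrite in_itv /=; have := ler_norm (v - a); have := ler_norm (a - v).
  by rewrite distrC => h1 h2; apply/andP; split; lra.
have [c cK' cmin] : exists2 c, c \in K & forall u, u \in K -> `|v - c| <= `|v - u|.
  apply: (@compact_EVT_min R R (fun z => `|v - z|) K) => //; first by exists a.
  apply: (@lipschitz_within 1) => x y _ _; rewrite mul1r.
  by apply: le_trans (ler_dist_dist _ _) _; rewrite opprD addrACA subrr add0r opprK addrC distrC.
exists c; move: cK'; rewrite inE => -[Xc _]; split=> // u Xu.
have [uK|uK] := pselect (K u); first by apply: cmin; rewrite inE.
have : `|v - a| < `|v - u|.
  rewrite ltNge; apply/negP; rewrite ler_norml => /andP[h1 h2]; apply: uK; split=> //=.
  by rewrite in_itv /=; apply/andP; split; lra.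
by move/ltW; apply: le_trans; apply: cmin; rewrite inE.
Qed.

Section Projection.
Variables (X : set R) (v : R).
Hypotheses (X_closed : closed X) (X_neq0 : X !=set0) (X_itv : interval_like X).

Let Pv := proj_nearest v X_closed X_neq0.

Lemma proj_in : X (proj X v). Proof. by case: Pv. Qed.

Let proj_self : X v -> proj X v = v.
Proof.
move=> Xv; have [_ /(_ _ Xv)] := Pv.
by rewrite subrr normr0 normr_le0 subr_eq0 => /eqP.
Qed.

(** If v is outside X, it cannot separate two points of the interval X, so u and the projection lie
    on the same side and the projection is no farther away. The bounds below follow from this. *)
Lemma proj_between u : X u ->
  u <= proj X v <= v \/ v <= proj X v <= u.
Proof.
move=> Xu; have [PX /(_ _ Xu) Pn] := Pv.
have [Xv|nXv] := pselect (X v).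
  by rewrite proj_self // lexx !andbT; have [] := leP u v; [left|right; exact: ltW].
have side w : X w -> (w < v) || (v < w).
  by move=> Xw; rewrite -neq_lt; apply: contra_notN nXv => /eqP <-.
have := side _ Xu; have := side _ PX.
case/orP => pv /orP[] uv.
- left; move: Pn; rewrite !gtr0_norm ?subr_gt0 // => Pn; apply/andP; split; lra.
- by case: nXv; apply: (X_itv PX Xu); rewrite !ltW.
- by case: nXv; apply: (X_itv Xu PX); rewrite !ltW.
- right; move: Pn; rewrite ![`|v - _|]distrC !gtr0_norm ?subr_gt0 // => Pn.
  by apply/andP; split; lra.
Qed.

Lemma proj_close u : X u -> `|proj X v - u| <= `|v - u|.
Proof.
by move=> /proj_between[] /andP[h1 h2];
  [rewrite !ger0_norm|rewrite !ler0_norm]; lra.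
Qed.

Lemma proj_le_max y : X y -> proj X v <= Num.max v y.
Proof.
by move=> /proj_between[] /andP[h1 h2]; rewrite le_max ?h1 ?h2 ?orbT.
Qed.

Lemma proj_ge_min y : X y -> Num.min v y <= proj X v.
Proof.
by move=> /proj_between[] /andP[h1 h2]; rewrite ge_min ?h1 ?h2 ?orbT.
Qed.

End Projection.
End ConvexAnalysis.

(** * Valid weights and valid optima *)

Definition valid_weights (R : realType) (n : nat) (F : {set 'I_n}) (beta : R)
    (gamma : nat) (alpha : 'I_n -> R) : Prop :=
  [/\ forall i, i \notin F -> 0 <= alpha i,
      \sum_(i | i \notin F) alpha i = 1 &
      (gamma <= #|[set i | (i \notin F) && (beta <= alpha i)%R]%SET|)%N].

(** * Minimizers of weighted sums *)

Section MinimizerSide.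
Variables (R : realType) (n : nat) (F : {set 'I_n}) (X : set R) (L : R).
Variables (h dh : 'I_n -> R -> R) (alpha : 'I_n -> R).
Hypothesis X_itv : interval_like X.
Hypothesis h_sub : forall i, subgradient_on X (h i) (dh i).
Hypothesis dh_le : forall i x, X x -> `|dh i x| <= L.
Hypothesis h_min : forall i, argmin X (h i) !=set0.
Hypothesis alpha_ge0 : forall i, i \notin F -> 0 <= alpha i.

Let p x := \sum_(i | i \notin F) alpha i * h i x.
Let dp x := \sum_(i | i \notin F) alpha i * dh i x.

Lemma combination_subgradient : subgradient_on X p dp.
Proof.
move=> z y Xz Xy; rewrite mulr_suml -big_split /=; apply: ler_sum => i iF.
by rewrite -mulrA -mulrDr ler_wpM2l ?alpha_ge0 ?h_sub.
Qed.

(** Left of z the subgradient inequality keeps [p] at least [p z]; right of b, beyond all chosen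
    local minimizers, no [h i] falls below [h i b]. A minimizer over [z, b] is thus a global one. *)
Lemma argmin_right z : X z -> dp z <= 0 -> exists2 c, argmin X p c & z <= c.
Proof.
move=> Xz dpz.
have [m mP] := choice h_min.
pose b := \big[Num.max/z]_i m i.
have zb : z <= b by exact: bigmax_ge_id.
have mb i : m i <= b by exact: le_bigmax.
have Xb : X b.
  by rewrite /b; elim/big_ind: _ => // [u v Xu Xv|i _]; [case: leP|case: (mP i)].
have p_lip x y : `[z, b]%classic x -> `[z, b]%classic y ->
    `|p x - p y| <= (\sum_(i | i \notin F) alpha i * L) * `|x - y|.
  have inX u : `[z, b]%classic u -> X u.
    by rewrite /= in_itv /= => zub; exact: (X_itv Xz Xb).
  move=> /inX Xx /inX Xy.
  have half u v : X u -> X v ->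
      p u - p v <= (\sum_(i | i \notin F) alpha i * L) * `|u - v|.
    move=> Xu Xv; rewrite -sumrB mulr_suml; apply: ler_sum => i iF.
    rewrite -mulrBr -mulrA ler_wpM2l ?alpha_ge0 //.
    have := h_sub i Xu Xv.
    have : `|dh i u * (v - u)| <= L * `|u - v|.
      by rewrite normrM distrC ler_wpM2r ?dh_le.
    by rewrite ler_norml => /andP[? ?]; lra.
  rewrite ler_norml half // andbT lerNl opprB distrC; exact: half.
have [c] := EVT_min zb (lipschitz_within p_lip).
rewrite in_itv /= => /andP[zc cb] cmin; exists c => //; split.
  by apply: (X_itv Xz Xb); rewrite zc.
move=> y Xy; have [yz|zy] := leP y z.
  apply: le_trans (cmin z _) _; first by rewrite in_itv /= lexx.
  have := combination_subgradient Xz Xy.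
  by have : 0 <= dp z * (y - z); [rewrite mulr_le0 ?subr_le0|lra].
have [yb|/ltW byy] := leP y b; first by apply: cmin; rewrite in_itv /= yb ltW.
apply: le_trans (cmin b _) _; first by rewrite in_itv /= lexx zb.
apply: ler_sum => i iF; rewrite ler_wpM2l ?alpha_ge0 //.
have [Xm mmin] := mP i; have := h_sub i Xb Xy.
have [bm|bm] := eqVneq b (m i); first by rewrite bm => _; exact: mmin.
have := h_sub i Xb Xm; have := mmin b Xb => h1 h2.
have mb0 : 0 < b - m i by rewrite subr_gt0 lt_neqAle eq_sym bm mb.
have : 0 <= dh i b by nra.
by nra.
Qed.

End MinimizerSide.

(** The reflection x -> -x of [argmin_right]. *)
Lemma argmin_left (R : realType) (n : nat) (F : {set 'I_n}) (X : set R) (L : R)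
    (h dh : 'I_n -> R -> R) (alpha : 'I_n -> R) (z : R) :
  interval_like X -> (forall i, subgradient_on X (h i) (dh i)) ->
  (forall i x, X x -> `|dh i x| <= L) -> (forall i, argmin X (h i) !=set0) ->
  (forall i, i \notin F -> 0 <= alpha i) ->
  X z -> 0 <= \sum_(i | i \notin F) alpha i * dh i z ->
  exists2 c, argmin X (fun x => \sum_(i | i \notin F) alpha i * h i x) c & c <= z.
Proof.
move=> Xitv hsub dhL hmin a0 Xz dpz.
have [||||||c [Xc cmin] zc] := @argmin_right R n F (fun x => X (- x)) L
   (fun i x => h i (- x)) (fun i x => - dh i (- x)) alpha _ _ _ _ a0 (- z).
- move=> a b c Xa Xb acb; apply: (Xitv _ _ _ Xb Xa).
  by rewrite !lerN2 andbC.
- move=> i u v Xu Xv; have := hsub i _ _ Xu Xv; lra.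
- by move=> i x /dhL; rewrite normrN.
- move=> i; have [m [Xm mmin]] := hmin i; exists (- m); split=> [|y Xy].
    by rewrite opprK.
  by rewrite opprK; exact: mmin.
- by rewrite opprK.
- rewrite opprK; under eq_bigr do rewrite mulrN.
  by rewrite sumrN oppr_le0.
exists (- c); last by rewrite lerNl.
by split=> // y Xy; have := cmin (- y); rewrite opprK; apply.
Qed.

Section WeightGeometry.
Variables (R : realType) (n : nat) (F : {set 'I_n}) (beta : R) (gamma : nat).
Local Notation valid := (valid_weights F beta gamma).

(* The weights that put [beta] on each agent of some set [S] of size at least
   [gamma] and the remaining mass on a minimizer of [v] minimize
   [sum alpha i * v i]; there are finitely many of them. *)
Lemma valid_weights_pos (v : 'I_n -> R) : 0 <= beta ->
  (forall alpha, valid alpha -> 0 < \sum_(i | i \notin F) alpha i * v i) ->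
  exists2 kappa, 0 < kappa &
    forall alpha, valid alpha -> kappa <= \sum_(i | i \notin F) alpha i * v i.
Proof.
move=> beta0 pos.
have [noN|/existsNP[i0 /negP i0F]] := pselect (forall i, i \in F).
  exists 1 => // alpha [_ + _]; rewrite big_pred0 => [/eqP|i]; last by rewrite noN.
  by rewrite eq_sym oner_eq0.
pose m := [arg min_(i < i0 | i \notin F) v i]%O.
have [mF m_min] : m \notin F /\ forall i, i \notin F -> v m <= v i.
  by rewrite /m; case: arg_minP.
pose ok (S : {set 'I_n}) :=
  [&& [disjoint S & F]%B, (gamma <= #|S|)%N & beta * #|S|%:R <= 1].
pose w (S : {set 'I_n}) i := beta * (i \in S)%:R + (1 - beta * #|S|%:R) * (i == m)%:R.
have sumw (S : {set 'I_n}) (u : 'I_n -> R) :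
    \sum_(i | i \notin F) w S i * u i =
    \sum_(i | i \notin F) beta * (i \in S)%:R * u i + (1 - beta * #|S|%:R) * u m.
  under eq_bigr do rewrite mulrDl; rewrite big_split /=; congr (_ + _).
  rewrite (bigD1 m) //= eqxx mulr1 big1 ?addr0 // => i /andP[_ /negbTE ->].
  by rewrite mulr0 mul0r.
have massS (S : {set 'I_n}) : [disjoint S & F]%B ->
    \sum_(i | i \notin F) beta * (i \in S)%:R = beta * #|S|%:R.
  move=> dSF; rewrite -mulr_sumr; congr (_ * _).
  rewrite -sum1_card natr_sum big_mkcond [RHS]big_mkcond /=; apply: eq_bigr => i _.
  by case: ifP => iF; case: ifP => // iS; rewrite (disjointFr dSF iS) in iF.
have w_valid S : ok S -> valid (w S).
  case/and3P=> dSF gS bS; split.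
  - by move=> i _; rewrite addr_ge0 // mulr_ge0 // subr_ge0.
  - transitivity (\sum_(i | i \notin F) w S i * 1).
      by apply: eq_bigr => i _; rewrite mulr1.
    rewrite sumw.
    under eq_bigr do rewrite mulr1.
    by rewrite massS // mulr1 addrC subrK.
  - apply: (leq_trans gS); apply: subset_leq_card; apply/fintype.subsetP => i iS.
    rewrite inE (disjointFr dSF iS) /= /w iS mulr1 lerDl.
    by rewrite mulr_ge0 // subr_ge0.
(* Taking beta off each agent of S leaves nonnegative weights, as S collects the agents weighing at
   least beta; moving this remainder to m can only lower the sum. *)
have alpha_ge alpha : valid alpha -> exists2 S, ok S &
    \sum_(i | i \notin F) w S i * v i <= \sum_(i | i \notin F) alpha i * v i.
  move=> [a0 a1 ag]; pose S := [set i | (i \notin F) && (beta <= alpha i)%R]%SET.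
  have dSF : [disjoint S & F]%B.
    by rewrite disjoint_subset; apply/fintype.subsetP => i; rewrite !inE => /andP[].
  have gap_ge0 i : i \notin F -> 0 <= alpha i - beta * (i \in S)%:R.
    move=> iF; rewrite subr_ge0; case iS: (i \in S); rewrite ?mulr0 ?a0 //.
    by move: iS; rewrite inE mulr1 => /andP[].
  have bS : beta * #|S|%:R <= 1.
    by rewrite -massS // -[leRHS]a1 -subr_ge0 -sumrB; apply: sumr_ge0 => i; exact: gap_ge0.
  have okS : ok S by rewrite /ok dSF ag bS.
  exists S => //; rewrite sumw -lerBrDl -sumrB.
  rewrite -(massS _ dSF) -{1}a1 -sumrB mulr_suml; apply: ler_sum => i iF.
  by rewrite -mulrBl ler_wpM2l ?gap_ge0 ?m_min.
(* Without any such set there are no valid weights, and every kappa will do. *)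
have [[S0 S0ok]|noS] := pselect (exists S, ok S); last first.
  by exists 1 => // alpha /alpha_ge[S okS]; case: noS; exists S.
exists (\sum_(i | i \notin F) w [arg min_(S < S0 | ok S)
    (\sum_(i | i \notin F) w S i * v i)]%O i * v i).
  by case: arg_minP => // S okS _; exact/pos/w_valid.
move=> alpha /alpha_ge[S okS]; apply: le_trans.
by case: arg_minP => // S1 _; apply.
Qed.

(** The uniform weights are at least beta on every agent, so mixing with them brings no agent from
    above the threshold to below it. *)
Lemma valid_weights_mix alpha t : valid alpha -> 0 <= t <= 1 ->
  beta * #|~: F|%:R <= 1 ->
  valid (fun i => t * alpha i + (1 - t) * #|~: F|%:R^-1).
Proof.
move=> [a0 a1 ag] /andP[t0 t1] bm.
have sum1 : \sum_(i | i \notin F) #|~: F|%:R^-1 = 1 :> R.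
  have cE : \sum_(i | i \notin F) #|~: F|%:R^-1 = #|~: F|%:R^-1 *+ #|~: F| :> R.
    rewrite -[RHS]sumr_const; apply: eq_bigl => i; by rewrite inE.
  rewrite cE -[LHS]mulr_natl divff // pnatr_eq0 cards_eq0; apply/eqP => F0.
  move: a1; rewrite big_pred0 => [/eqP|i]; first by rewrite eq_sym oner_eq0.
  by have := finset.in_set0 i; rewrite -F0 inE.
have m_gt0 : 0 < #|~: F|%:R :> R.
  rewrite lt_neqAle ler0n andbT; apply/eqP => m0.
  have := sum1; rewrite -m0 invr0 big1 // => /eqP.
  by rewrite eq_sym oner_eq0.
split.
- by move=> i iF; rewrite addr_ge0 // mulr_ge0 ?a0 ?invr_ge0 ?subr_ge0.
- by rewrite big_split /= -!mulr_sumr a1 sum1; ring.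
- apply: (leq_trans ag); apply: subset_leq_card; apply/fintype.subsetP => i.
  rewrite !inE => /andP[-> ba] /=.
  have : beta <= #|~: F|%:R^-1 by rewrite -div1r ler_pdivlMr.
  by nra.
Qed.

End WeightGeometry.

(** * The set of valid optima *)

Section ValidOptima.
Variables (R : realType) (n : nat) (F : {set 'I_n}) (X : set R) (L : R).
Variables (h dh : 'I_n -> R -> R) (beta : R) (gamma : nat).
Hypothesis X_itv : interval_like X.
Hypothesis h_sub : forall i, subgradient_on X (h i) (dh i).
Hypothesis dh_le : forall i x, X x -> `|dh i x| <= L.
Hypothesis h_min : forall i, argmin X (h i) !=set0.
Local Notation Y := (valid_optima X h F beta gamma).
Local Notation valid := (valid_weights F beta gamma).
Local Notation dp alpha z := (\sum_(i | i \notin F) alpha i * dh i z).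

Lemma valid_optimaP y : Y y <-> exists2 alpha, valid alpha &
  argmin X (fun x => \sum_(i | i \notin F) alpha i * h i x) y.
Proof.
split=> [[p [alpha [a0 a1 ag ->]] yp]|[alpha [a0 a1 ag] yp]].
  by exists alpha.
by exists (fun x => \sum_(i | i \notin F) alpha i * h i x) => //; exists alpha.
Qed.

Lemma valid_optima_sub y : Y y -> X y.
Proof. by case=> p _ []. Qed.

Lemma valid_optima_nonempty alpha : X !=set0 -> valid alpha -> Y !=set0.
Proof.
move=> [z Xz] va; have [a0 _ _] := va.
have [dz|/ltW dz] := leP (dp alpha z) 0.
  have [c cP _] := argmin_right X_itv h_sub dh_le h_min a0 Xz dz.
  by exists c; apply/valid_optimaP; exists alpha.
have [c cP _] := argmin_left X_itv h_sub dh_le h_min a0 Xz dz.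
by exists c; apply/valid_optimaP; exists alpha.
Qed.

(** Were the slope at z nonpositive for some valid weights, [argmin_right] would give a valid
    optimum at or beyond z; [valid_weights_pos] makes the positivity uniform. *)
Lemma valid_optima_drift_above z : 0 <= beta -> X z -> (forall y, Y y -> y < z) ->
  exists2 kappa, 0 < kappa & forall alpha, valid alpha -> kappa <= dp alpha z.
Proof.
move=> b0 Xz Yz; apply: valid_weights_pos => // alpha va.
rewrite ltNge; apply/negP => dz; have [a0 _ _] := va.
have [c cP zc] := argmin_right X_itv h_sub dh_le h_min a0 Xz dz.
have /Yz : Y c by apply/valid_optimaP; exists alpha.
by rewrite ltNge zc.
Qed.

Lemma valid_optima_drift_below z : 0 <= beta -> X z -> (forall y, Y y -> z < y) ->
  exists2 kappa, 0 < kappa & forall alpha, valid alpha -> dp alpha z <= - kappa.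
Proof.
move=> b0 Xz Yz.
have [|kappa k0 kP] := @valid_weights_pos _ _ F beta gamma (fun i => - dh i z) b0.
  move=> alpha va; under eq_bigr do rewrite mulrN.
  rewrite sumrN oppr_gt0 ltNge; apply/negP => dz; have [a0 _ _] := va.
  have [c cP zc] := argmin_left X_itv h_sub dh_le h_min a0 Xz dz.
  have /Yz : Y c by apply/valid_optimaP; exists alpha.
  by rewrite ltNge zc.
exists kappa => // alpha /kP; under eq_bigr do rewrite mulrN.
by rewrite sumrN lerNr.
Qed.

(* The set of valid weights is star-shaped around the uniform weights, so that
   the values of [dp alpha z] form an interval. *)
Lemma valid_optima_interval : beta * #|~: F|%:R <= 1 -> interval_like Y.
Proof.
move=> bm y1 y2 z Y1 Y2 /andP[y1z zy2].
have Xz : X z.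
  by apply: (X_itv (valid_optima_sub Y1) (valid_optima_sub Y2)); rewrite y1z.
have [->//|ne1] := eqVneq z y1; have [->//|ne2] := eqVneq z y2.
have {}y1z : y1 < z by rewrite lt_neqAle eq_sym ne1.
have {}zy2 : z < y2 by rewrite lt_neqAle ne2.
have zero alpha : valid alpha -> dp alpha z = 0 -> Y z.
  move=> va dz; apply/valid_optimaP; exists alpha => //; split=> // y Xy.
  have [a0 _ _] := va; have := combination_subgradient h_sub a0 Xz Xy.
  by rewrite dz mul0r addr0.
have mix alpha s : s = \sum_(i | i \notin F) #|~: F|%:R^-1 * dh i z ->
    valid alpha -> dp alpha z * s <= 0 -> Y z.
  (* The t at which the mixed slope [t * dp alpha z + (1 - t) * s] vanishes. If both slopes agree,
     the sign condition forces them to be 0, and t = 0 serves. *)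
  rewrite -mulr_sumr => sE va ds; pose t := if s == dp alpha z then 0 else s / (s - dp alpha z).
  have t01 : 0 <= t <= 1.
    rewrite /t; case: eqP => [_|/eqP ne]; first by rewrite lexx ler01.
    have sd : s - dp alpha z != 0 by rewrite subr_eq0.
    case: (ltgtP s (dp alpha z)) ne => // lt _.
      rewrite -mulrNN -invrN opprB divr_ge0 ?ler_pdivrMr ?mul1r; nra.
    by rewrite divr_ge0 ?ler_pdivrMr ?mul1r; nra.
  apply: (zero _ (valid_weights_mix va t01 bm)).
  under eq_bigr do rewrite mulrDl -!mulrA; rewrite big_split /= -!mulr_sumr -sE.
  rewrite /t; case: eqP => [sd|/eqP ne].
    by move: ds; rewrite -sd; nra.
  by field; rewrite subr_eq0.
have /valid_optimaP[a1 va1 [X1 min1]] := Y1.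
have /valid_optimaP[a2 va2 [X2 min2]] := Y2.
have d1 : 0 <= dp a1 z.
  have [a0 _ _] := va1; have := combination_subgradient h_sub a0 Xz X1.
  by have := min1 z Xz; nra.
have d2 : dp a2 z <= 0.
  have [a0 _ _] := va2; have := combination_subgradient h_sub a0 Xz X2.
  by have := min2 z Xz; nra.
(* The slope at z is nonnegative for a1 and nonpositive for a2, so one of them is opposite in sign
   to the uniform slope s. *)
pose s := \sum_(i | i \notin F) #|~: F|%:R^-1 * dh i z.
have [s0|/ltW s0] := leP s 0.
  by apply: (mix a1 s); rewrite // mulr_ge0_le0.
by apply: (mix a2 s); rewrite // mulr_le0_ge0.
Qed.

End ValidOptima.

(** Transfers convergence from the threshold that the matrices provide to a smaller one, possibly
    negative, whereas the drift bounds ask for a nonnegative threshold. *)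
Lemma valid_optima_le (R : realType) (n : nat) (F : {set 'I_n}) (X : set R)
    (h : 'I_n -> R -> R) (beta beta' : R) (gamma : nat) : beta <= beta' ->
  valid_optima X h F beta' gamma `<=` valid_optima X h F beta gamma.
Proof.
move=> bb y /valid_optimaP[alpha [a0 a1 ag] ya].
apply/valid_optimaP; exists alpha => //; split=> //.
apply: (leq_trans ag); apply: subset_leq_card; apply/fintype.subsetP => i.
by rewrite !inE => /andP[-> /(le_trans bb)].
Qed.

(** A point with points of Y on both sides lies in Y; otherwise one of the two bounds puts it within
    eps of Y. *)
Lemma dist_to_cvg0 (R : realType) (x : R^nat) (Y : set R) : interval_like Y ->
  (forall eps, 0 < eps -> exists T, forall t, (T <= t)%N ->
     exists2 y, Y y & x t <= y + eps) ->
  (forall eps, 0 < eps -> exists T, forall t, (T <= t)%N ->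
     exists2 y, Y y & y - eps <= x t) ->
  dist_to (x t) Y @[t --> \oo] --> 0%E.
Proof.
move=> Yitv above below.
have near_Y eps : 0 < eps -> exists T, forall t, (T <= t)%N ->
    (0 <= dist_to (x t) Y <= eps%:E)%E.
  move=> e0; have [T1 T1P] := above _ e0; have [T2 T2P] := below _ e0.
  exists (maxn T1 T2) => t; rewrite geq_max => /andP[/T1P[y1 Yy1 h1] /T2P[y2 Yy2 h2]].
  apply/andP; split; first by apply: le_ereal_inf_tmp => _ [y _ <-]; rewrite lee_fin.
  suff [y Yy xy] : exists2 y, Y y & `|x t - y| <= eps.
    apply: (@le_trans _ _ (`|x t - y|)%:E); last by rewrite lee_fin.
    by apply: ereal_inf_lbound; exists y.
  have [xy1|y1x] := leP (x t) y1; last first.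
    by exists y1 => //; rewrite gtr0_norm ?subr_gt0 //; lra.
  have [y2x|xy2] := leP y2 (x t); last first.
    by exists y2 => //; rewrite ltr0_norm ?subr_lt0 //; lra.
  exists (x t); last by rewrite subrr normr0 ltW.
  by apply: (Yitv _ _ _ Yy2 Yy1); rewrite y2x.
have fin T t eps : (0 <= dist_to (x t) Y <= eps%:E)%E -> dist_to (x t) Y \is a fin_num.
  by move=> /andP[d0 de]; rewrite ge0_fin_numE // (le_lt_trans de) // ltry.
apply/fine_cvgP; split.
  have [T HT] := near_Y 1 ltr01; exists T => // t /= /HT; exact: fin.
apply/cvgrPdist_le => eps e0; have [T HT] := near_Y eps e0.
exists T => // t /= /HT dt; have /andP[d0 de] := dt.
rewrite sub0r normrN ger0_norm ?fine_ge0 // -lee_fin fineK //; exact: fin dt.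
Qed.

(** * Trimmed means *)

Section TrimmedMean.
Local Open Scope set_scope.
Local Open Scope ring_scope.

Lemma sum_indicator (R : realType) (n : nat) (A : {set 'I_n}) (g : 'I_n -> R) :
  \sum_j (j \in A)%:R * g j = \sum_(j in A) g j.
Proof.
rewrite [RHS]big_mkcond; apply: eq_bigr => j _.
by case: (j \in A); rewrite ?mul1r ?mul0r.
Qed.

Lemma sum_indicator1 (R : realType) (n : nat) (A : {set 'I_n}) :
  \sum_j (j \in A)%:R = #|A|%:R :> R.
Proof.
rewrite -[LHS](_ : \sum_j (j \in A)%:R * 1 = _); last by under eq_bigr do rewrite mulr1.
by rewrite sum_indicator sumr_const.
Qed.

(* If all of [S] or all of [U] is faulty, then no member of [K] is, and the
   members of [K] are their own representatives. Otherwise half of each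
   non-faulty value of [K], and the whole of each faulty one, is written as a
   convex combination of the means of the non-faulty values in [S] and in [U];
   one of these two means gets weight at least 1/2. *)
Lemma trim_weights (R : realType) (n f : nat) (v : 'I_n -> R)
    (S K U F : {set 'I_n}) (k0 : R) :
  [disjoint S & K]%B -> [disjoint K & U]%B -> [disjoint S & U]%B ->
  #|S| = f -> #|U| = f -> (#|F| <= f)%N ->
  (forall s k, s \in S -> k \in K -> v s <= v k) ->
  (forall k u, k \in K -> u \in U -> v k <= v u) ->
  k0 <= 1 -> 4 * f%:R * k0 <= 1 -> ((0 < f)%N -> (0 < #|K|)%N) ->
  exists c : 'I_n -> R,
    [/\ forall j, 0 <= c j,
        forall j, j \notin (S :|: K :|: U) :\: F -> c j = 0,
        \sum_j c j = #|K|%:R,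
        \sum_j c j * v j = \sum_(j in K) v j &
        (#|[set j in (S :|: K :|: U) :\: F | (c j < k0)%R]| <= f)%N].
Proof.
move=> dSK dKU dSU cS cU cF vSK vKU k01 k04 K_gt0.
(* With Z inside F, counting gives Z = F; then K is free of faults and the light agents all lie in
   Z'. *)
have one_side (Z Z' : {set 'I_n}) : Z :\: F = finset.set0 -> [disjoint Z & K]%B ->
    #|Z| = f -> #|Z'| = f -> Z :|: K :|: Z' = S :|: K :|: U ->
    exists c : 'I_n -> R,
    [/\ forall j, 0 <= c j,
        forall j, j \notin (S :|: K :|: U) :\: F -> c j = 0,
        \sum_j c j = #|K|%:R,
        \sum_j c j * v j = \sum_(j in K) v j &
        (#|[set j in (S :|: K :|: U) :\: F | (c j < k0)%R]| <= f)%N].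
  move=> /eqP; rewrite finset.setD_eq0 => ZF dZK cZ cZ' <-.
  have FZ : F = Z by apply/esym/eqP; rewrite eqEcard ZF cZ cF.
  exists (fun j => (j \in K)%:R); split.
  - by move=> j; exact: ler0n.
  - move=> j; rewrite !inE FZ; case jK: (j \in K) => //=.
    by rewrite (disjointFl dZK jK) orbT.
  - exact: sum_indicator1.
  - exact: sum_indicator.
  - rewrite -cZ'; apply: subset_leq_card; apply/fintype.subsetP => j.
    rewrite !inE FZ; case jK: (j \in K) => /=.
      by rewrite ltNge k01 andbF.
    by case: (j \in Z); case: (j \in Z').
have [S0|[s1 s1P]] := set_0Vmem (S :\: F); first exact: (one_side S U).
have [U0|[u1 u1P]] := set_0Vmem (U :\: F).
  by apply: (one_side U S); rewrite // ?[[disjoint U & K]%B]disjoint_sym //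
    finset.setUAC (finset.setUC U) finset.setUAC finset.setUC finset.setUA.
have f_gt0 : (0 < f)%N.
  by rewrite -cS card_gt0; apply/set0Pn; exists s1; move: s1P; rewrite inE => /andP[].
have fR : 1 <= f%:R :> R by rewrite ler1n.
have k0_4 : k0 <= 1 / 4 by nra.
pose mean (Z : {set 'I_n}) : R := (\sum_(j in Z) v j) / #|Z|%:R.
have card0 (Z : {set 'I_n}) z : z \in Z -> 0 < #|Z|%:R :> R.
  by move=> zZ; rewrite ltr0n card_gt0; apply/set0Pn; exists z.
have cSF := card0 _ _ s1P; have cUF := card0 _ _ u1P.
have cSF_le : #|S :\: F|%:R <= f%:R :> R.
  by rewrite ler_nat -cS subset_leq_card // finset.subsetDl.
have cUF_le : #|U :\: F|%:R <= f%:R :> R.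
  by rewrite ler_nat -cU subset_leq_card // finset.subsetDl.
have meanS k : k \in K -> mean (S :\: F) <= v k.
  move=> kK; rewrite ler_pdivrMr // mulr_natr -sumr_const; apply: ler_sum => j.
  by rewrite inE => /andP[_ jS]; exact: vSK.
have meanU k : k \in K -> v k <= mean (U :\: F).
  move=> kK; rewrite ler_pdivlMr // mulr_natr -sumr_const; apply: ler_sum => j.
  by rewrite inE => /andP[_ jU]; exact: vKU.
pose share (j : 'I_n) : R := if j \in F then 1 else 1 / 2.
have share_ge j : 1 / 2 <= share j by rewrite /share; case: ifP; lra.
have share_split (g : 'I_n -> R) :
    \sum_(j in K) share j * g j + 1 / 2 * \sum_(j in K :\: F) g j = \sum_(j in K) g j.
  rewrite mulr_sumr (big_mkcond (fun j => j \in K :\: F)) (big_mkcond (fun j => j \in K)).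
  rewrite -big_split [RHS]big_mkcond /=; apply: eq_bigr => j _; rewrite inE /share.
  by case: (j \in F); case: (j \in K) => /=; lra.
pose Es := \sum_(j in K) share j.
have Es_half : 1 / 2 <= Es.
  have := K_gt0 f_gt0; rewrite card_gt0 => /set0Pn[k kK].
  rewrite /Es (bigD1 k) //=; have := share_ge k.
  have : 0 <= \sum_(i in K | i != k) share i.
    by apply: sumr_ge0 => j _; apply: le_trans (share_ge j); lra.
  by lra.
have [th /andP[th0 th1] thE] : exists2 th, 0 <= th <= 1 &
    (\sum_(j in K) share j * v j) / Es
      = th * mean (S :\: F) + (1 - th) * mean (U :\: F).
  apply: interpolation; apply/andP; split.
    rewrite ler_pdivlMr; last by lra.
    rewrite mulrC mulr_suml; apply: ler_sum => j jK.
    by rewrite ler_wpM2l ?meanS //; have := share_ge j; lra.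
  rewrite ler_pdivrMr; last by lra.
  rewrite mulrC mulr_suml; apply: ler_sum => j jK.
  by rewrite ler_wpM2l ?meanU //; have := share_ge j; lra.
pose p := Es * (th / #|S :\: F|%:R); pose q := Es * ((1 - th) / #|U :\: F|%:R).
have p0 : 0 <= p by rewrite /p mulr_ge0 ?divr_ge0 ?(ltW cSF) //; lra.
have q0 : 0 <= q by rewrite /q mulr_ge0 ?divr_ge0 ?(ltW cUF) //; lra.
pose c (j : 'I_n) := 1 / 2 * (j \in K :\: F)%:R + p * (j \in S :\: F)%:R
  + q * (j \in U :\: F)%:R : R.
have sum_c (g : 'I_n -> R) : \sum_j c j * g j = 1 / 2 * \sum_(j in K :\: F) g j
    + p * \sum_(j in S :\: F) g j + q * \sum_(j in U :\: F) g j.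
  rewrite -!sum_indicator !mulr_sumr -!big_split /=.
  by apply: eq_bigr => j _; rewrite /c; ring.
have c_ge0 j : 0 <= c j by rewrite /c !addr_ge0 ?mulr_ge0 ?ler0n //; lra.
exists c; split=> //.
- move=> j; rewrite /c !inE; case: (j \in F) => /=; first by rewrite !mulr0 !addr0.
  by case: (j \in S); case: (j \in K); case: (j \in U) => //= _; rewrite !mulr0 !addr0.
- have := share_split (fun=> 1); have := sum_c (fun=> 1).
  under eq_bigr do rewrite mulr1; move=> ->.
  under eq_bigr do rewrite mulr1; rewrite -/Es !sumr_const => <-.
  rewrite /p /q; have cS0 := gt_eqF cSF; have cU0 := gt_eqF cUF.
  by field; rewrite cS0 cU0.
- rewrite sum_c -share_split.
  have -> : \sum_(j in K) share j * v j
      = Es * (th * mean (S :\: F) + (1 - th) * mean (U :\: F)).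
    by rewrite -thE mulrC divfK // gt_eqF //; lra.
  rewrite /p /q /mean; have cS0 := gt_eqF cSF; have cU0 := gt_eqF cUF.
  by field; rewrite cS0 cU0.
(* Here [4 * f%:R * k0 <= 1] enters: at least half of a total share of at least 1/2 is spread over
   at most f agents. *)
have big_weight (m t : R) : 0 < m -> m <= f%:R -> 1 / 2 <= t -> k0 <= Es * (t / m).
  move=> m0 mf t2; rewrite mulrA ler_pdivlMr //.
  have : 1 / 4 <= Es * t by nra.
  have [k0n|k0p] := leP k0 0; first by nra.
  by nra.
(* The light agents all lie on the side opposite to the heavier mean, and that side has f
   members. *)
have [th2|th2] := leP (1 / 2) th.
- have pk : k0 <= p by exact: big_weight.
  rewrite -cU; apply: subset_leq_card; apply/fintype.subsetP => j.
  rewrite !inE /c !inE; case: (j \in F) => //=; case: (j \in U); rewrite ?orbT //.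
  rewrite !orbF mulr0 addr0.
  have [jS|jS] := boolP (j \in S).
    by rewrite (disjointFr dSK jS) /= ltNge mulr0 add0r mulr1 pk.
  case: (j \in K) => //=; rewrite ltNge mulr0 addr0 mulr1.
  by rewrite (_ : k0 <= 1 / 2) //; lra.
- have qk : k0 <= q by apply: big_weight => //; lra.
  rewrite -cS; apply: subset_leq_card; apply/fintype.subsetP => j.
  rewrite !inE /c !inE; case: (j \in F) => //=; case: (j \in S) => //=.
  rewrite mulr0 addr0.
  have [jU|jU] := boolP (j \in U).
    by rewrite (disjointFl dKU jU) /= ltNge mulr0 add0r mulr1 qk.
  rewrite orbF; case: (j \in K) => //=; rewrite ltNge mulr0 addr0 mulr1.
  by rewrite (_ : k0 <= 1 / 2) //; lra.
Qed.

Lemma trimmed_split (R : realType) (n f : nat) (v : 'I_n -> R) (I K : {set 'I_n}) :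
  trimmed f v I K -> (2 * f <= #|I|)%N ->
  exists S U : {set 'I_n},
    [/\ S :|: K :|: U = I,
        [/\ [disjoint S & K]%B, [disjoint K & U]%B & [disjoint S & U]%B],
        [/\ #|S| = f, #|U| = f & #|K| = (#|I| - 2 * f)%N],
        forall s k, s \in S -> k \in K -> v s <= v k &
        forall k u, k \in K -> u \in U -> v k <= v u].
Proof.
case=> s [s_perm s_sorted ->] If.
have s_size : size s = #|I| by rewrite (perm_size s_perm) cardE.
have s_uniq : uniq s by rewrite (perm_uniq s_perm) enum_uniq.
have s_mem j : (j \in s) = (j \in I) by rewrite (perm_mem s_perm) mem_enum.
set k := (size s - 2 * f)%N.
pose s1 := take f s; pose s2 := take k (drop f s); pose s3 := drop k (drop f s).
have sE : s = s1 ++ s2 ++ s3 by rewrite /s1 /s2 /s3 !cat_take_drop.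
have v_trans : transitive (fun i j : 'I_n => v i <= v j) by move=> ? ? ?; exact: le_trans.
have pw : pairwise (fun i j : 'I_n => v i <= v j) (s1 ++ s2 ++ s3).
  by rewrite -sE -sorted_pairwise.
move: pw; rewrite !pairwise_cat allrel_catr.
case/and3P=> /andP[/allrelP r12 _] _ /and3P[/allrelP r23 _ _].
have un : uniq (s1 ++ s2 ++ s3) by rewrite -sE.
move: un; rewrite !cat_uniq => /and3P[u1 /hasPn d1 /and3P[u2 /hasPn d2 u3]].
have disj (l1 l2 : seq 'I_n) : (forall j, j \in l2 -> j \notin l1) ->
    [disjoint [set j in l1]%SET & [set j in l2]%SET]%B.
  move=> d; rewrite disjoint_subset; apply/fintype.subsetP => j; rewrite !inE => j1.
  by apply/negP => /d; rewrite j1.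
have cardE' (l : seq 'I_n) : uniq l -> #|[set j in l]%SET| = size l.
  by move=> ul; rewrite cardsE; exact/card_uniqP.
exists [set j in s1]%SET, [set j in s3]%SET; split.
- by apply/finset.setP => j; rewrite !inE -s_mem [in RHS]sE !mem_cat -orbA.
- by split; apply: disj => j js; [apply: d1|apply: d2|apply: d1]; rewrite ?mem_cat js ?orbT.
- by rewrite !cardE' // /s1 /s3 !size_drop !size_take_min !size_drop /k s_size; split; lia.
- by move=> i j; rewrite !inE => is1 js2; apply: r12; rewrite ?mem_cat ?js2.
- by move=> i j; rewrite !inE; exact: r23.
Qed.

Lemma connect_cross (T : finType) (r : rel T) (A : {set T}) (x y : T) :
  connect r x y -> x \in A -> y \notin A ->
  exists a b, [/\ a \in A, b \notin A & r a b].
Proof.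
move=> /connectP[p + ->] {y}.
elim: p x => [|z p IHp] x /=; first by move=> _ ->.
move=> /andP[xz zp] xA yA; have [zA|zA] := boolP (z \in A); first exact: IHp yA.
by exists x, z.
Qed.

(** The agent itself joins with weight 1 before the division by the number [#|K| + 1] of averaged
    values. At most f non-faulty in-neighbors are light, so that dropping their edges leaves a
    reduced graph. *)
Lemma agent_weights (R : realType) (n f : nat) (v y : 'I_n -> R) (i : 'I_n)
    (I K F : {set 'I_n}) (k0 : R) :
  (#|F| <= f)%N -> i \notin F -> i \notin I -> (2 * f <= #|I|)%N ->
  ((0 < f)%N -> (2 * f < #|I|)%N) -> 0 <= k0 -> k0 <= 1 -> 4 * f%:R * k0 <= 1 ->
  (forall j, j \in I -> j \notin F -> v j = y j) -> trimmed f v I K ->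
  exists m : 'I_n -> R,
    [/\ (forall j, 0 <= m j) /\ (forall j, j \in F -> m j = 0), \sum_j m j = 1,
        (#|I|%:R + 1 - 2 * f%:R)^-1 <= m i,
        (#|I|%:R + 1 - 2 * f%:R)^-1 * (y i + \sum_(j in K) v j) = \sum_j m j * y j &
        (#|[set j in I :\: F | (m j < k0 * (#|I|%:R + 1 - 2 * f%:R)^-1)%R]| <= f)%N].
Proof.
move=> cF iF iI If fI k0_ge0 k01 k04 vy trK.
have [S [U [SKU [dSK dKU dSU] [cS cU cK] vSK vKU]]] := trimmed_split trK If.
have K_gt0 : (0 < f)%N -> (0 < #|K|)%N by move=> /fI; rewrite cK; lia.
have [c [c0 cz c1 cv clow]] := trim_weights dSK dKU dSU cS cU cF vSK vKU k01 k04 K_gt0.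
rewrite SKU in cz clow.
have cKR : #|K|%:R = #|I|%:R - 2 * f%:R :> R by rewrite cK natrB // natrM.
set a := #|I|%:R + 1 - 2 * f%:R.
have a_gt0 : 0 < a.
  have : 0 <= #|K|%:R :> R by [].
  by rewrite cKR /a; lra.
have ai0 : 0 < a^-1 by rewrite invr_gt0.
have sum_delta (g : 'I_n -> R) : \sum_j (j == i)%:R * g j = g i.
  rewrite (bigD1 i) //= eqxx mul1r big1 ?addr0 // => j /negbTE ->.
  by rewrite mul0r.
exists (fun j => a^-1 * ((j == i)%:R + c j)); split.
- split=> j; first by rewrite mulr_ge0 ?addr_ge0 // ltW.
  move=> jF; rewrite cz ?inE ?jF // addr0; case: eqP => [ji|_]; last exact: mulr0.
  by rewrite ji (negbTE iF) in jF.
- rewrite -mulr_sumr big_split /= c1 cKR.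
  have -> : \sum_j (j == i)%:R = 1 :> R.
    by rewrite -[RHS](sum_delta (fun=> 1)); apply: eq_bigr => j _; rewrite mulr1.
  by rewrite (_ : 1 + _ = a) ?mulVf ?gt_eqF // /a; ring.
- by rewrite eqxx ler_peMr ?lerDl // ltW.
- under [RHS]eq_bigr do rewrite -mulrA mulrDl; rewrite -mulr_sumr big_split /=.
  rewrite sum_delta -cv; congr (_ * (_ + _)); apply: eq_bigr => j _.
  have [jIF|jIF] := boolP (j \in I :\: F); last by rewrite cz // !mul0r.
  by move: jIF; rewrite inE => /andP[jF jI]; rewrite vy.
- apply: leq_trans clow; apply: subset_leq_card; apply/fintype.subsetP => j.
  rewrite !inE => /andP[/andP[-> jI]]; rewrite jI /= mulrC ltr_pM2r //.
  case: eqP => [ji|_]; first by rewrite ji (negbTE iI) in jI.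
  by rewrite add0r.
Qed.

End TrimmedMean.

(** * Reduced graphs *)

Section Graph.
Local Open Scope set_scope.
Local Open Scope ring_scope.
Variables (n f : nat) (e : rel 'I_n) (F : {set 'I_n}) (gamma : nat).
Hypothesis e_irr : irreflexive e.
Hypothesis e_assumption1 : assumption1 e f.
Hypothesis gamma_ge : (f + 1 <= gamma)%N.
Hypothesis gamma_source : forall H : {set 'I_n * 'I_n}, reduced_graph e f F H ->
  (gamma <= #|source_component F H|)%N.

(** [P j i] marks the edge from j to i for removal. *)
Lemma reduced_graph_missing (G : {set 'I_n}) (P : rel 'I_n) :
  (forall i, i \notin G ->
     #|[set j in in_nbrs e i :\: G | P j i]| <= f)%N ->
  reduced_graph e f G [set p in fault_free_edges e G | ~~ P p.1 p.2].
Proof.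
move=> Pf; apply/andP; split.
  by apply/fintype.subsetP => p; rewrite inE => /andP[].
apply/forall_inP => i iG; apply: leq_trans (Pf i iG).
apply: subset_leq_card; apply/fintype.subsetP => j; rewrite !inE /= iG /=.
by case: (j \in G); case: (e j i); case: (P j i).
Qed.

Lemma source_component_in (G : {set 'I_n}) (H : {set 'I_n * 'I_n}) s j :
  s \in source_component G H -> j \notin G ->
  connect (fun k l => (k, l) \in H) s j.
Proof. by rewrite inE => /andP[_ /forall_inP]; apply. Qed.

Lemma no_in_edge_source (G : {set 'I_n}) (H : {set 'I_n * 'I_n}) s i :
  i \notin G -> (forall k, (k, i) \notin H) ->
  s \in source_component G H -> s = i.
Proof.
move=> iG noH sS; apply/eqP; apply/negPn/negP => si.
have [||a [b [_]]] := connect_cross (A := [set~ i]) (source_component_in sS iG).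
- by rewrite !inE.
- by rewrite !inE eqxx.
by rewrite !inE negbK => /eqP -> ; rewrite (negbTE (noH a)).
Qed.

(** Otherwise all edges entering i from non-faulty agents could be removed, and the source component
    would be at most {i}, whereas gamma >= f + 1 >= 2. *)
Lemma nonfaulty_in_degree i : (0 < f)%N -> i \notin F ->
  (f < #|in_nbrs e i :\: F|)%N.
Proof.
move=> f0 iF; rewrite ltnNge; apply/negP => small.
have Hred : reduced_graph e f F [set p in fault_free_edges e F | ~~ (p.2 == i)].
  apply: (reduced_graph_missing (P := fun _ k => k == i)) => k kF.
  case: (eqVneq k i) => [->|ki]; last first.
    rewrite (_ : #|_| = 0%N) //; apply/eqP; rewrite cards_eq0.
    by apply/eqP/finset.setP => j; rewrite !inE andbF.
  apply: leq_trans small; apply: subset_leq_card; apply/fintype.subsetP => j.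
  by rewrite inE => /andP[].
have := gamma_source Hred.
suff : (#|source_component F [set p in fault_free_edges e F | ~~ (p.2 == i)]| <= 1)%N.
  by move: gamma_ge; lia.
rewrite -(cards1 i); apply: subset_leq_card; apply/fintype.subsetP => s sS.
rewrite inE; apply/eqP; apply: (no_in_edge_source iF _ sS) => k.
by rewrite inE /= eqxx andbF.
Qed.

(** Otherwise let f in-neighbors of i form a faulty set G and isolate i: its at most f other
    in-edges go, and every other agent loses only its edge from i. The source can then only be i, so
    all other agents lie in G, although i has more than f in-neighbors. *)
Lemma in_degree_gt i : (0 < f)%N -> i \notin F -> (2 * f < in_degree e i)%N.
Proof.
move=> f0 iF; rewrite ltnNge; apply/negP => small.
have big := nonfaulty_in_degree f0 iF.
have fI : (f < #|in_nbrs e i|)%N.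
  by apply: leq_trans big _; rewrite subset_leq_card // finset.subsetDl.
have [G /andP[GI /eqP cG]] : exists G : {set 'I_n}, (G \subset in_nbrs e i) && (#|G| == f).
  have : (0 < #|[set G : {set 'I_n} | (G \subset in_nbrs e i) && (#|G| == f)]|)%N.
    by rewrite cards_draws bin_gt0 ltnW.
  by rewrite card_gt0 => /set0Pn[G]; rewrite inE; exists G.
have iG : i \notin G.
  by apply/negP => /(fintype.subsetP GI); rewrite inE e_irr.
pose P (j k : 'I_n) := (k == i) || (j == i).
have Hred : reduced_graph e f G [set p in fault_free_edges e G | ~~ P p.1 p.2].
  apply: reduced_graph_missing => k kG.
  case: (eqVneq k i) => [->|ki].
    apply: (@leq_trans #|in_nbrs e i :\: G|).
      by apply: subset_leq_card; apply/fintype.subsetP => j; rewrite inE => /andP[].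
    by rewrite finset.cardsD (finset.setIidPr GI) cG; move: small; rewrite /in_degree; lia.
  apply: leq_trans f0; rewrite -(cards1 i); apply: subset_leq_card.
  by apply/fintype.subsetP => j; rewrite !inE /P (negbTE ki) => /andP[].
have := e_assumption1 (F := G) _ Hred; rewrite cG leqnn => /(_ isT) /set0Pn[s sS].
have noin k : (k, i) \notin [set p in fault_free_edges e G | ~~ P p.1 p.2].
  by rewrite inE /P /= eqxx andbF.
have si := no_in_edge_source iG noin sS.
have allG j : j != i -> j \in G.
  move=> ji; apply/negPn/negP => jG.
  have [||a [b [/set1P ai _]]] := connect_cross (A := [set i]) (source_component_in sS jG).
  - by rewrite si set11.
  - by rewrite inE.
  by rewrite inE /P /= ai eqxx orbT andbF.
have : (#|in_nbrs e i| <= #|G|)%N.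
  apply: subset_leq_card; apply/fintype.subsetP => j; rewrite inE => ji.
  by apply: allG; apply/eqP => jE; rewrite jE e_irr in ji.
by rewrite cG leqNgt fI.
Qed.

Lemma num_reduced_graphs_gt0 : (0 < num_reduced_graphs e f F)%N.
Proof.
rewrite card_gt0; apply/set0Pn.
exists [set p in fault_free_edges e F | ~~ false]; rewrite inE.
apply: (reduced_graph_missing (P := fun _ _ => false)) => i _.
rewrite (_ : [set _ in _ | _] = finset.set0) ?cards0 //.
by apply/finset.setP => j; rewrite !inE andbF.
Qed.

Lemma nonfaulty_gt : (f < #|~: F|)%N.
Proof.
have [H Hred] : exists H, reduced_graph e f F H.
  by have := num_reduced_graphs_gt0; rewrite card_gt0 => /set0Pn[H]; rewrite inE; exists H.
have := gamma_source Hred.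
have : (#|source_component F H| <= #|~: F|)%N.
  by apply: subset_leq_card; apply/fintype.subsetP => i; rewrite !inE => /andP[].
by move: gamma_ge; lia.
Qed.

(** Any single edge into i may be removed, and the more than f choices give distinct reduced
    graphs. *)
Lemma num_reduced_graphs_gt : (0 < f)%N -> (f < num_reduced_graphs e f F)%N.
Proof.
move=> f0; have := nonfaulty_gt => m_gt.
have : (0 < #|~: F|)%N by lia.
rewrite card_gt0 => /set0Pn[i]; rewrite inE => iF.
apply: (leq_trans (nonfaulty_in_degree f0 iF)).
pose del j := [set p in fault_free_edges e F | ~~ ((p.1 == j) && (p.2 == i))].
have del_inj : {in in_nbrs e i :\: F &, injective del}.
  move=> j k; rewrite !inE => /andP[jF ji] /andP[kF ki] /finset.setP/(_ (j, i)).
  rewrite !inE /= jF iF ji eqxx !andbT /=; case: (j =P k) => // _.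
  by rewrite eqxx.
rewrite -(card_in_imset del_inj); apply: subset_leq_card.
apply/fintype.subsetP => _ /imsetP[j _ ->]; rewrite inE.
apply: (reduced_graph_missing (P := fun a b => (a == j) && (b == i))) => k _.
apply: leq_trans f0; rewrite -(cards1 j); apply: subset_leq_card.
by apply/fintype.subsetP => a; rewrite !inE => /andP[_ /andP[]].
Qed.

(** Gives [4 * f%:R * k0 <= 1] for k0 = 2^-tau, as the trimming weights demand, through 4f <=
    2^(f+1) and f < tau. *)
Lemma four_f_le : (4 * f <= 2 ^ num_reduced_graphs e f F)%N.
Proof.
have [->//|f0] := posnP f.
apply: (@leq_trans (2 ^ f.+1)); last first.
  by rewrite leq_exp2l // num_reduced_graphs_gt.
case: (f) f0 => // g _; elim: g => // g IHg.
by rewrite expnS; move: IHg; lia.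
Qed.

End Graph.

(** * Weights built up along a recurring reduced graph *)

Section Source.
Local Open Scope set_scope.
Local Open Scope ring_scope.
Variables (R : realType) (n : nat) (M : nat -> 'M[R]_n) (F : {set 'I_n}).
Variables (Red : {set {set 'I_n * 'I_n}}) (H : nat -> {set 'I_n * 'I_n}) (A k0 : R).
Hypothesis M_stoch : forall t, stochastic (M t).
Hypothesis A_ge1 : 1 <= A.
Hypothesis k0_ge0 : 0 <= k0.
Hypothesis k0_le1 : k0 <= 1.
Hypothesis self_weight : forall t i, i \notin F -> A^-1 <= M t i i.
Hypothesis edge_weight : forall t i j, (j, i) \in H t ->
  i \notin F /\ k0 * A^-1 <= M t i j.
Hypothesis H_red : forall t, H t \in Red.

Let hits H0 t d := (\sum_(u < d) (H (t + u) == H0))%N.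

(* Each time [H0] occurs the set of agents reached from [s] grows, unless it
   already contains all non-faulty agents; its size counts the steps that used
   an edge rather than a self-loop. *)
Lemma reach H0 s t d : s \in source_component F H0 ->
  exists Q : {set 'I_n}, [/\ s \in Q, Q \subset ~: F,
    (minn #|~: F| (hits H0 t d).+1 <= #|Q|)%N &
    forall k, k \in Q -> k0 ^+ #|Q| * A^-1 ^+ d <= transition M d t k s].
Proof.
move=> sS; have sF : s \notin F by move: sS; rewrite inE => /andP[].
have minS a b c : (minn a b.+1 <= c -> minn a b.+2 <= 1 + c)%N by lia.
have A0 : 0 <= A^-1 by rewrite invr_ge0 (le_trans _ A_ge1).
elim: d => [|d [Q [sQ QF cQ wQ]]].
  (* The set {s} is charged one factor [k0] although the entry is 1; this makes the exponent exactly
     [#|Q|], at most m in the end. *)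
  exists [set s]; rewrite cards1; split.
  - exact: set11.
  - by rewrite finset.sub1set inE.
  - by rewrite /hits big_ord0 geq_minr.
  by move=> k /set1P ->; rewrite expr1 expr0 mulr1 mxE eqxx.
have hitsS : hits H0 t d.+1 = (hits H0 t d + (H (t + d) == H0))%N.
  by rewrite /hits big_ord_recr.
have W0 d' k : 0 <= transition M d' t k s.
  exact: (transition_stochastic M_stoch d' t).1.
have M0 i j : 0 <= M (t + d)%N i j by exact: (M_stoch _).1.
have step_ge k j (c1 c2 : R) : 0 <= c1 -> c1 <= M (t + d)%N k j -> c2 <= transition M d t j s ->
    c1 * c2 <= transition M d.+1 t k s.
  move=> c10 h1 h2; rewrite transitionS mxE (bigD1 j) //=.
  apply: (@le_trans _ _ (M (t + d)%N k j * transition M d t j s)).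
    by apply: le_trans (ler_wpM2l c10 h2) _; rewrite ler_wpM2r.
  by rewrite lerDl; apply: sumr_ge0 => l _; rewrite mulr_ge0.
have stay k : k \in Q -> k0 ^+ #|Q| * A^-1 ^+ d.+1 <= transition M d.+1 t k s.
  move=> kQ; have kF : k \notin F by have := fintype.subsetP QF k kQ; rewrite inE.
  by have := step_ge k k _ _ A0 (self_weight _ kF) (wQ k kQ); rewrite exprS mulrCA.
have [full|] := eqVneq Q (~: F).
  by exists Q; split=> //; rewrite full geq_minl.
have [HH|HH] := eqVneq (H (t + d)) H0; last first.
  by move=> _; exists Q; split=> //; rewrite hitsS (negbTE HH) addn0.
(* A path in [H0] from s to a missing agent leaves Q along some edge (a, b), and b joins Q at the
   price of one factor [k0]. *)
rewrite finset.eqEsubset QF /= => /fintype.subsetPn[j]; rewrite inE => jF jQ.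
have [a [b [aQ bQ ab]]] := connect_cross (source_component_in sS jF) sQ jQ.
have [bF wab] : b \notin F /\ k0 * A^-1 <= M (t + d)%N b a by apply: edge_weight; rewrite HH.
exists (b |: Q); rewrite cardsU1 bQ /=; split.
- by rewrite inE sQ orbT.
- by rewrite finset.subUset finset.sub1set inE bF.
- by rewrite hitsS HH eqxx addn1; exact: minS.
move=> k; rewrite inE => /orP[/set1P ->|kQ]; last first.
  apply: le_trans (stay k kQ); rewrite ler_wpM2r ?exprn_ge0 //.
  by rewrite exprS ler_piMl ?exprn_ge0.
have := step_ge b a _ _ (mulr_ge0 k0_ge0 A0) wab (wQ a aQ).
by rewrite !exprS mulrACA.
Qed.

Lemma pigeonhole t : (0 < #|Red|)%N -> (0 < #|~: F|)%N ->
  exists2 H0, H0 \in Red & (#|~: F| <= hits H0 t (#|Red| * #|~: F|))%N.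
Proof.
move=> Red0 m0; apply: contrapT => no.
have few H0 : H0 \in Red -> (hits H0 t (#|Red| * #|~: F|) <= #|~: F|.-1)%N.
  move=> HR; rewrite -ltnS prednK // ltnNge; apply/negP => hm.
  by apply: no; exists H0.
have : (\sum_(H0 in Red) hits H0 t (#|Red| * #|~: F|) <= #|Red| * #|~: F|.-1)%N.
  by rewrite -[leqRHS]sum_nat_const; apply: leq_sum.
rewrite exchange_big /= (eq_bigr (fun=> 1%N)) => [|u _]; last first.
  rewrite (bigD1 (H (t + u))) //= eqxx big1 // => H0 /andP[_].
  by rewrite eq_sym => /negbTE ->.
rewrite sum_nat_const card_ord muln1 leq_pmul2l //.
by rewrite leqNgt prednK // leqnn.
Qed.

(** With m hits the set Q of [reach] must contain all non-faulty agents. *)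
Lemma source_weight t : (0 < #|Red|)%N -> (0 < #|~: F|)%N ->
  exists2 H0, H0 \in Red & forall s, s \in source_component F H0 ->
    forall k, k \notin F -> k0 ^+ #|~: F| * A^-1 ^+ (#|Red| * #|~: F|) <=
      transition M (#|Red| * #|~: F|) t k s.
Proof.
move=> Red0 m0; have [H0 HR hm] := pigeonhole t Red0 m0.
exists H0 => // s sS k kF.
have [Q [sQ QF cQ wQ]] := reach t (#|Red| * #|~: F|) sS.
have QE : Q = ~: F.
  apply/eqP; rewrite eqEcard QF; apply: leq_trans cQ.
  by rewrite leq_min leqnn ltnW.
by rewrite QE in wQ; apply: wQ; rewrite inE.
Qed.

End Source.

(** * Executions *)

Lemma stepsizes_to0 (R : realType) (lambda : R^nat) : stepsizes lambda ->
  forall eps, 0 < eps -> exists T, forall t, (T <= t)%N -> lambda t <= eps.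
Proof.
case=> l0 _ _ /cvg_series_cvg_0 sq0 eps e0.
have e2 : 0 < eps ^+ 2 by rewrite exprn_gt0.
move: sq0 => /cvgrPdist_le/(_ _ e2)[T _ HT]; exists T => t /HT /=.
rewrite sub0r normrN ger0_norm ?exprn_ge0 ?(ltW (l0 t)) //.
by rewrite ler_pXn2r // nnegrE ltW.
Qed.

Lemma stepsizes_sum (R : realType) (lambda : R^nat) : stepsizes lambda ->
  forall T A, exists q, A <= \sum_(u < q) lambda (T + u)%N.
Proof.
case=> l0 _ /cvgryPge sum _ T A.
have [q0 _ Hq] := sum (A + \sum_(0 <= k < T) lambda k).
exists q0; have := Hq (T + q0)%N (leq_addl _ _); rewrite /series /=.
rewrite (big_cat_nat _ (leq_addr q0 T)) //= addrC lerD2r.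
rewrite -{1}[T]add0n big_addn addKn big_mkord.
by under eq_bigr do rewrite addnC.
Qed.

Section Execution.
Variables (R : realType) (n f : nat) (e : rel 'I_n) (F : {set 'I_n}).
Variables (X : set R) (L : R) (h dh : 'I_n -> R -> R) (lambda : R^nat) (gamma : nat).
Hypothesis e_irr : irreflexive e.
Hypothesis e_assumption1 : assumption1 e f.
Hypothesis F_le : (#|F| <= f)%N.
Hypothesis X_neq0 : X !=set0.
Hypothesis X_closed : closed X.
Hypothesis X_convex : @convex_set R R^o X.
Hypothesis h_adm : forall i, admissible X L (h i) (dh i).
Hypothesis lambda_step : stepsizes lambda.
Hypothesis gamma_ge : (f + 1 <= gamma)%N.
Hypothesis gamma_source : forall H : {set 'I_n * 'I_n}, reduced_graph e f F H ->
  (gamma <= #|source_component F H|)%N.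
Variables (x : 'I_n -> R^nat) (w : nat -> 'I_n -> 'I_n -> R).
Hypothesis exec : execution e f F X dh lambda x w.

Local Notation m := #|~: F|.
Local Notation tau := (num_reduced_graphs e f F).
Local Notation A := ((max_in_degree e)%:R + 1 - 2 * f%:R : R).
(** Chosen so that [b] equals 1 / (2A)^(tau m): the m edge factors [k0] make up 2^-(tau m). *)
Local Notation k0 := (2 ^- tau : R).
Local Notation B := (tau * m)%N.
Local Notation b := (k0 ^+ m * A^-1 ^+ B).

Let X_itv : interval_like X := convex_set_interval X_convex.

Let h_sub i : subgradient_on X (h i) (dh i).
Proof. by have [hc [hd _] _ _ _] := h_adm i; exact: convex_subgradient. Qed.

Let dh_le i x0 : X x0 -> `|dh i x0| <= L.
Proof. by have [_ _ _ + _] := h_adm i; apply. Qed.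

Let h_min i : argmin X (h i) !=set0.
Proof. by have [_ _ _ _ []] := h_adm i. Qed.

Let m_gt0 : (0 < m)%N.
Proof. exact: leq_ltn_trans (nonfaulty_gt gamma_ge gamma_source). Qed.

Let i0P : exists i, i \notin F.
Proof. by have := m_gt0; rewrite card_gt0 => /set0Pn[i]; rewrite inE; exists i. Qed.

Lemma degree_bounds i : i \notin F ->
  [/\ (2 * f <= in_degree e i)%N, (0 < f)%N -> (2 * f < in_degree e i)%N,
      1 <= (in_degree e i)%:R + 1 - 2 * f%:R :> R &
      (in_degree e i)%:R + 1 - 2 * f%:R <= A].
Proof.
move=> iF; have d_gt f0 := in_degree_gt e_irr e_assumption1 gamma_ge gamma_source f0 iF.
have d_ge : (2 * f <= in_degree e i)%N.
  by case: (posnP f) => [->|/d_gt/ltnW].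
split=> //.
  by rewrite addrAC lerDr subr_ge0 -natrM ler_nat.
by rewrite !lerD2r ler_nat; exact: leq_bigmax.
Qed.

Let A_ge1 : 1 <= A.
Proof. by have [i /degree_bounds[_ _ + ]] := i0P; exact: le_trans. Qed.

Let k0_gt0 : 0 < k0. Proof. by rewrite invr_gt0 exprn_gt0. Qed.

Let k0_le1 : k0 <= 1.
Proof. by rewrite invf_le1 ?exprn_gt0 // exprn_ege1 // ler1n. Qed.

Let k0_f : 4 * f%:R * k0 <= 1.
Proof.
rewrite ler_pdivrMr ?exprn_gt0 // mul1r -natrX -natrM ler_nat.
exact: (four_f_le gamma_ge gamma_source).
Qed.

Let state_in t i : i \notin F -> X (x i t).
Proof.
have [x0 _ step] := exec; case: t => [|t] iF //.
by have [K [_ ->]] := step t i iF; exact: proj_in.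
Qed.

Let B_gt0 : (0 < B)%N.
Proof.
rewrite muln_gt0 m_gt0 andbT; exact: num_reduced_graphs_gt0.
Qed.

Let b_gt0 : 0 < b.
Proof. by rewrite mulr_gt0 ?exprn_gt0 // invr_gt0 (lt_le_trans ltr01). Qed.

(* Faulty agents are replaced by copies of a non-faulty one, so that the whole
   state vector follows a dynamics with row-stochastic matrices. *)
Lemma execution_matrices : exists (r : 'I_n -> 'I_n) (M : nat -> 'M[R]_n)
    (H : nat -> {set 'I_n * 'I_n}),
  [/\ (forall i, r i \notin F) /\ (forall i, i \notin F -> r i = i),
      (forall t, stochastic (M t)) /\ (forall t i j, j \in F -> M t i j = 0),
      (forall t i j, M t i j = M t (r i) j) /\
        (forall t i, i \notin F -> A^-1 <= M t i i),
      (forall t, reduced_graph e f F (H t)) /\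
        (forall t i j, (j, i) \in H t -> i \notin F /\ k0 * A^-1 <= M t i j) &
      forall t i, x (r i) t.+1 = proj X
        (average (M t) (fun j => x (r j) t) i - lambda t * dh (r i) (x (r i) t))].
Proof.
have [i0 i0F] := i0P; have [_ wE step] := exec.
pose a i : R := (in_degree e i)%:R + 1 - 2 * f%:R.
have row (ti : nat * 'I_n) : exists mu : 'I_n -> R, ti.2 \notin F ->
    [/\ (forall j, 0 <= mu j) /\ (forall j, j \in F -> mu j = 0), \sum_j mu j = 1,
        (a ti.2)^-1 <= mu ti.2,
        x ti.2 ti.1.+1 = proj X (\sum_j mu j * x j ti.1
          - lambda ti.1 * dh ti.2 (x ti.2 ti.1)) &
        (#|[set j in in_nbrs e ti.2 :\: F | (mu j < k0 * (a ti.2)^-1)%R]%SET| <= f)%N].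
  case: ti => t i /=; have [iF|_] := boolP (i \notin F); last by exists (fun=> 0).
  have [K [trK xE]] := step t i iF; have [d1 d2 _ _] := degree_bounds iF.
  have iI : i \notin in_nbrs e i by rewrite inE e_irr.
  have wx j : j \in in_nbrs e i -> j \notin F -> w t i j = x j t.
    by rewrite inE => ji jF; exact: wE.
  have [mu [mu0 mu1 mui muE mulow]] := agent_weights F_le iF iI d1 d2
    (ltW k0_gt0) k0_le1 k0_f wx trK.
  by exists mu => _; split=> //; rewrite xE muE.
have [mu muP] := choice row.
pose r i := if i \in F then i0 else i.
have rF i : r i \notin F by rewrite /r; case: ifPn.
have rE i : i \notin F -> r i = i by rewrite /r; case: ifP.
pose M t : 'M[R]_n := \matrix_(i, j) mu (t, r i) j.
(* Edges of weight at least k0 / A are kept; at most f non-faulty in-neighbors of an agent fall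
   below even the larger bound k0 / a. *)
pose H t := [set p in fault_free_edges e F | (k0 * A^-1 <= mu (t, p.2) p.1)%R]%SET.
have aA i : i \notin F -> A^-1 <= (a i)^-1.
  move=> iF; have [_ _ a1 aA] := degree_bounds iF.
  by rewrite lef_pV2 // posrE (lt_le_trans ltr01) // (le_trans a1).
exists r, M, H; split; only 1-4: split=> //.
- move=> t; split=> [i j|i].
    by rewrite mxE; have [[mu0 _] _ _ _ _] := muP (t, r i) (rF i).
  by under eq_bigr do rewrite mxE; have [_ mu1 _ _ _] := muP (t, r i) (rF i).
- move=> t i j jF; rewrite mxE.
  by have [[_ muF] _ _ _ _] := muP (t, r i) (rF i); exact: muF.
- by move=> t i j; rewrite !mxE (rE _ (rF i)).
- move=> t i iF; rewrite mxE rE //; have [_ _ mui _ _] := muP (t, i) iF.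
  exact: le_trans (aA i iF) mui.
- move=> t; apply/andP; split; first by apply/fintype.subsetP => p; rewrite inE => /andP[].
  apply/forall_inP => i iF; have [_ _ _ _] := muP (t, i) iF; apply: leq_trans.
  apply: subset_leq_card; apply/fintype.subsetP => j; rewrite !inE /= iF /=.
  rewrite negb_and -ltNge => /andP[+ /andP[jF ji]].
  rewrite jF ji /= => mulow; apply: lt_le_trans mulow _.
  by rewrite ler_pM2l // aA.
- move=> t i j; rewrite inE /= => /andP[]; rewrite inE => /and3P[_ /= iF _].
  by rewrite mxE rE.
- move=> t i; have [[_ muF] _ _ /= xE _] := muP (t, r i) (rF i); rewrite xE.
  congr (proj X (_ - _)); apply: eq_bigr => j _; rewrite mxE.
  by have [jF|jF] := boolP (j \in F); [rewrite muF // !mul0r|rewrite (rE j jF)].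
Qed.

Let bE : 1 / (2 * A) ^+ (tau * (n - #|F|)) = b.
Proof.
have -> : (n - #|F|)%N = m by have := cardsC F; rewrite card_ord; lia.
by rewrite div1r exprMn invfM !exprVn -exprM.
Qed.

(** Puts b at or below the uniform weight 1/m, as the interval property of the valid optima
    requires. *)
Let b_m : b * m%:R <= 1.
Proof.
have bm : b <= 2 ^- m.
  apply: (@le_trans _ _ (k0 ^+ m)).
    rewrite ler_piMr ?exprn_ge0 ?(ltW k0_gt0) // exprn_ile1 ?invr_ge0 ?(le_trans ler01) //.
    by rewrite invf_le1 // (lt_le_trans ltr01).
  rewrite exprVn -exprM lef_pV2 ?posrE ?exprn_gt0 // ler_eXn2l ?ltr1n // leq_pmull //.
  exact: num_reduced_graphs_gt0.
apply: (@le_trans _ _ (2 ^- m * m%:R)); first by rewrite ler_wpM2r.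
by rewrite mulrC ler_pdivrMr ?exprn_gt0 // mul1r -natrX ler_nat ltnW // ltn_expl.
Qed.

Lemma execution_converges beta : beta <= 1 / (2 * A) ^+ (tau * (n - #|F|)) ->
  (forall i j, i \notin F -> j \notin F -> `|x i t - x j t| @[t --> \oo] --> (0 : R)) /\
  (forall i, i \notin F ->
    dist_to (x i t) (valid_optima X h F beta gamma) @[t --> \oo] --> 0%E).
Proof.
rewrite bE => betab; have betam : beta * m%:R <= 1.
  by apply: le_trans b_m; rewrite ler_wpM2r.
have [l0 l_noninc _ _] := lambda_step.
have l_to0 := stepsizes_to0 lambda_step; have l_sum := stepsizes_sum lambda_step.
have [i0 i0F] := i0P.
have [r [M [H [[rF rE] [M_st MF] [Mr M_self] [H_red H_edge] step]]]] := execution_matrices.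
pose y i t := x (r i) t; pose g i t := dh (r i) (x (r i) t).
have yX t i : X (y i t) by exact: state_in.
have L_ge0 : 0 <= L.
  by case: X_neq0 => z Xz; exact: le_trans (normr_ge0 _) (dh_le i0 Xz).
have avgX t i : X (average (M t) (y^~ t) i).
  have [lo [hi lohi]] := exists_extrema (y^~ t) i0.
  apply: (X_itv (yX t lo) (yX t hi)); apply/andP; split.
    by apply: average_ge => // k; case/andP: (lohi k).
  by apply: average_le => // k; case/andP: (lohi k).
have close t i : `|y i t.+1 - average (M t) (y^~ t) i| <= L * lambda t.
  rewrite /y step; apply: le_trans (proj_close _ X_closed X_neq0 X_itv (avgX t i)) _.
  rewrite addrAC subrr add0r normrN normrM gtr0_norm // mulrC ler_pM2r //.
  exact/dh_le/yX.
have sources t : exists H0, reduced_graph e f F H0 /\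
    forall s, s \in source_component F H0 -> forall k, b <= transition M B t k s.
  pose Red := [set H0 | reduced_graph e f F H0]%SET.
  have H_Red u : H u \in Red by rewrite inE.
  have [|//|H0 H0R wH0] := source_weight M_st A_ge1 (ltW k0_gt0) k0_le1 M_self H_edge
    H_Red t.
    exact: num_reduced_graphs_gt0.
  exists H0; split=> [|s sS k]; first by rewrite inE in H0R.
  (* The last factor has the same row for a faulty agent as for its representative. *)
  have -> : transition M B t k s = transition M B t (r k) s.
    rewrite -(prednK B_gt0) transitionS !mxE; apply: eq_bigr => j _.
    by rewrite Mr.
  exact: wH0.
have cons := consensus M_st l0 l_noninc l_to0 L_ge0 close B_gt0 b_gt0.
have {}cons eps : 0 < eps ->
    exists T, forall t, (T <= t)%N -> forall i j, `|y i t - y j t| <= eps.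
  apply: cons => t; have [H0 [H0red wH0]] := sources t.
  have : (0 < #|source_component F H0|)%N.
    by apply: leq_trans (gamma_source H0red); move: gamma_ge; rewrite addn1; exact: leq_trans.
  by rewrite card_gt0 => /set0Pn[s sS]; exists s; exact: wH0.
(* Since d > 0, the product has [M s] as its rightmost factor, whose columns at faulty agents
   vanish. *)
have WF d s i k : (B <= d)%N -> k \in F -> transition M d s i k = 0.
  case: d => [|d] Bd kF; first by move: (leq_trans B_gt0 Bd).
  by rewrite /= mxE big1 // => j _; rewrite MF // mulr0.
have W_valid d s i : (B <= d)%N ->
    valid_weights F b gamma (fun k => transition M d s i k).
  move=> Bd; have [W0 W1] := transition_stochastic M_st d s; split=> //.
    rewrite -(W1 i) [RHS](bigID (fun k => k \in F)) /= [X in _ = X + _]big1 ?add0r //.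
    by move=> k kF; exact: WF.
  (* The first block bounds the columns of at least gamma source agents below by b, and the later
     steps preserve this. *)
  have [H0 [H0red wH0]] := sources s.
  apply: (leq_trans (gamma_source H0red)); apply: subset_leq_card.
  apply/fintype.subsetP => k kS; rewrite inE; move: (kS); rewrite inE => /andP[-> _] /=.
  by rewrite -(subnK Bd); apply: transition_ge_col => // j; exact: wH0.
have W_avg d s i u : (B <= d)%N -> average (transition M d s) (g^~ u) i =
    \sum_(k | k \notin F) transition M d s i k * dh k (y k u).
  move=> Bd; rewrite /average (bigID (fun k => k \in F)) /= big1 ?add0r.
    by apply: eq_bigr => k kF; rewrite /g /y rE.
  by move=> k kF; rewrite WF // mul0r.
pose Y := valid_optima X h F b gamma.
have [y1 Y1] : Y !=set0.
  exact: (valid_optima_nonempty X_itv h_sub dh_le h_min X_neq0 (W_valid B 0%N i0 _)).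
have X1 : X y1 := valid_optima_sub Y1.
have above := @eventually_le_near R n M lambda y g L B Y y1 M_st l0 l_noninc l_to0
  l_sum L_ge0 close _ cons Y1 _.
have {}above eps : 0 < eps -> exists T, forall t, (T <= t)%N ->
    forall i, exists2 z, Y z & y i t <= z + eps.
  apply: above => [t i|z Yz].
    by rewrite /y step; exact: proj_le_max.
  (* For z outside the interval X, the point y1 < z of X rules out states at or above z; the premise
     is void and kappa = 1 serves. *)
  have [Xz|nXz] := pselect (X z); last first.
    exists 1 => // t zy; case: nXz; apply: (X_itv X1 (yX t i0)).
    by rewrite zy andbT ltW // Yz.
  have [kappa kappa0 kP] := valid_optima_drift_above X_itv h_sub dh_le h_min
    (ltW b_gt0) Xz Yz.
  exists kappa => // t zy d s i Bd; rewrite W_avg //.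
  (* The derivatives are nondecreasing, so at states above z they are at least those at z, where the
     row, being valid weights, yields kappa. *)
  apply: le_trans (kP _ (W_valid d s i Bd)) _; apply: ler_sum => k _.
  apply: ler_wpM2l; first exact: (transition_stochastic M_st d s).1.
  exact: subgradient_monotone (h_sub k) Xz (yX t k) (zy k).
(* The bound from below is the bound from above for the negated states, gradients and optima. *)
have below := @eventually_le_near R n M lambda (fun i t => - y i t)
  (fun i t => - g i t) L B [set z | Y (- z)] (- y1) M_st l0 l_noninc l_to0
  l_sum L_ge0 _ _ _ _ _.
have {}below eps : 0 < eps -> exists T, forall t, (T <= t)%N ->
    forall i, exists2 z, Y z & z - eps <= y i t.
  move=> e0; have [|||||T HT] := below _ _ _ _ _ eps e0.
  - by move=> t i; rewrite averageN /= -opprD normrN; exact: close.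
  - move=> t i; rewrite averageN /= mulrN -opprD lerNl.
    rewrite oppr_max !opprK /y step; exact: proj_ge_min.
  - move=> eps' e'0; have [T HT] := cons eps' e'0; exists T => t Tt i j /=.
    by rewrite -opprD normrN; exact: HT.
  - by rewrite /= opprK.
  - move=> z Yz; have Yz' u : Y u -> - z < u.
      by move=> Yu; rewrite ltrNl; apply: Yz; rewrite /= opprK.
    have [Xz|nXz] := pselect (X (- z)); last first.
      exists 1 => // t zy; case: nXz; apply: (X_itv (yX t i0) X1).
      by rewrite (ltW (Yz' _ Y1)) andbT -lerN2 opprK.
    have [kappa kappa0 kP] := valid_optima_drift_below X_itv h_sub dh_le h_min
      (ltW b_gt0) Xz Yz'.
    exists kappa => // t zy d s i Bd; rewrite averageN W_avg // lerNr.
    apply: le_trans (kP _ (W_valid d s i Bd)); apply: ler_sum => k _.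
    apply: ler_wpM2l; first exact: (transition_stochastic M_st d s).1.
    by apply: subgradient_monotone (h_sub k) (yX t k) Xz _; rewrite lerNr.
  exists T => t /HT Tt i; have [z Yz yz] := Tt i.
  by exists (- z) => //; rewrite -lerN2 opprB opprK addrC.
have yE i : i \notin F -> x i = y i by move=> iF; rewrite /y rE.
split=> [i j iF jF|i iF].
  apply/cvgrPdist_le => eps e0; have [T HT] := cons eps e0.
  by exists T => // t /= Tt; rewrite sub0r normrN normr_id !yE //; exact: HT.
have Ysub := @valid_optima_le R n F X h beta b gamma betab.
rewrite yE //; apply: dist_to_cvg0.
- exact: valid_optima_interval X_itv h_sub betam.
- move=> eps /above[T HT]; exists T => t /HT Tt; have [z Yz yz] := Tt i.
  by exists z => //; exact: Ysub.
- move=> eps /below[T HT]; exists T => t /HT Tt; have [z Yz yz] := Tt i.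
  by exists z => //; exact: Ysub.
Qed.

End Execution.

Theorem theorem2 (R : realType) (n f : nat) (e : rel 'I_n) (F : {set 'I_n})
  (X : set R) (L : R) (h dh : 'I_n -> R -> R) (lambda : R^nat)
  (beta : R) (gamma : nat)
  (e_irr : irreflexive e)
  (e_assumption1 : assumption1 e f)
  (F_le : (#|F| <= f)%N)
  (X_neq0 : X !=set0) (X_closed : closed X) (X_convex : @convex_set R R^o X)
  (h_adm : forall i, admissible X L (h i) (dh i))
  (lambda_step : stepsizes lambda)
  (gamma_ge : (f + 1 <= gamma)%N)
  (gamma_source : forall H : {set 'I_n * 'I_n}, reduced_graph e f F H ->
     (gamma <= #|source_component F H|)%N)
  (beta_le : beta <=
     1 / (2 * ((max_in_degree e)%:R + 1 - 2 * f%:R)) ^+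
           (num_reduced_graphs e f F * (n - #|F|))) :
  forall (x : 'I_n -> R^nat) (w : nat -> 'I_n -> 'I_n -> R),
    execution e f F X dh lambda x w ->
    (forall i j, i \notin F -> j \notin F ->
       `|x i t - x j t| @[t --> \oo] --> (0 : R)) /\
    (forall i, i \notin F ->
       dist_to (x i t) (valid_optima X h F beta gamma) @[t --> \oo] --> 0%E).
Proof.
move=> x w exec; exact: (execution_converges e_irr e_assumption1 F_le X_neq0
  X_closed X_convex h_adm lambda_step gamma_ge gamma_source exec beta_le).
Qed.
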